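(* Let $H$ be a separable complex Hilbert space and let $A\in\mathcal{B}_p(H)$ with $1\le p<2$. Then $$\frac{1}{2^{p/2+1}}\|A^*A+AA^*\|_{p/2}^{p/2}+\sup_{\theta\in\mathbb{R}}\frac{\Big|\,\|Re^2(e^{i\theta}A)\|_{p/2}^{p/2}-\|Im^2(e^{i\theta}A)\|_{p/2}^{p/2}\Big|}{2}\le w_p^p(A)\le\frac{1}{2^p}\|A^*A+AA^*\|_{p/2}^{p/2}+\frac{1}{2^{p/2}}\,w_{p/2}^{p/2}(A^2).$$
   Context: For $q>0$, $\mathcal{B}_q(H)$ is the $q$-Schatten class: the compact operators $A$ on $H$ with $\|A\|_q=\big(\sum_{i}s_i(A)^q\big)^{1/q}<\infty$, where $s_i(A)$ are the singular values of $A$ (for $0<q<1$ this is only a quasi-norm). For $T\in\mathcal{B}(H)$, $Re(T)=\frac{T+T^*}{2}$, $Im(T)=\frac{T-T^*}{2i}$, and $Re^2(T)=(Re(T))^2$, $Im^2(T)=(Im(T))^2$. For $q>0$ and $T\in\mathcal{B}_q(H)$, $w_q(T)=\sup_{\theta\in\mathbb{R}}\|Re(e^{i\theta}T)\|_q$; $w_q^s(T)$ means $(w_q(T))^s$. *)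

(* Defs.v *)
From HB Require Import structures.
From mathcomp Require Import all_boot all_order all_algebra.
From mathcomp Require Import complex.
From mathcomp Require Import all_classical all_reals all_analysis.

Set Implicit Arguments.
Unset Strict Implicit.
Unset Printing Implicit Defensive.

Import Order.TTheory GRing.Theory Num.Theory.
Import numFieldNormedType.Exports.

Local Open Scope classical_set_scope.
Local Open Scope card_scope.
Local Open Scope complex_scope.
Local Open Scope ring_scope.

(* A complex Hilbert space is a complete normed space H over R[i] whose norm
   comes from a positive definite Hermitian form ip; mathcomp's forms are
   linear in the first argument and conjugate-linear in the second. *)
Definition norm_from_ip (R : realType) (H : completeNormedModType R[i])
    (ip : {dot H for Num.conj}) : Prop :=
  forall x : H, `|x| ^+ 2 = ip x x.

Definition separable_space (T : topologicalType) : Prop :=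
  exists2 D : set T, countable D & dense D.

Definition expi (R : realType) (t : R) : R[i] := cos t +i* sin t.

Section Operators.
Context {R : realType} {H : completeNormedModType R[i]}.
Variable ip : {dot H for Num.conj}.
Implicit Types (T S : H -> H) (q : R).

(* The adjoint is unique when it exists, and it exists for every bounded
   linear T; the default value 0 is only taken outside that case. *)
Definition adjoint T : H -> H :=
  xget (fun=> 0) [set S | forall x y, ip (T x) y = ip x (S y)].

Definition re_op T : H -> H := fun x => 2^-1 *: (T x + adjoint T x).

Definition im_op T : H -> H := fun x => (2 * 'i%C)^-1 *: (T x - adjoint T x).

Definition op_sqr T : H -> H := T \o T.

Definition rotate (t : R) T : H -> H := fun x => expi t *: T x.

Definition abs_sum T : H -> H :=
  fun x => adjoint T (T x) + T (adjoint T x).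

Definition compact_operator T : Prop :=
  linear T /\ precompact (T @` [set x | `|x| <= 1]).

Definition op_eigenspace T (l : R[i]) : set H := [set x | T x = l *: x].

Definition has_dim (V : set H) (n : nat) : Prop :=
  exists e : 'I_n -> H,
    (forall c : 'I_n -> R[i], \sum_i c i *: e i = 0 -> forall i, c i = 0) /\
    V = [set \sum_i c i *: e i | c in [set: 'I_n -> R[i]]].

(* The singular values are the square roots of the eigenvalues of T^* T, in
   decreasing order, each l > 0 being repeated as often as the dimension of
   the eigenspace for l^2; the sequence is padded with zeros if T has finite
   rank. For compact T these conditions determine s. *)
Definition is_singular_values T (s : nat -> R) : Prop :=
  [/\ nonincreasing_seq s,
      forall i, 0 <= s i &
      forall l : R, 0 < l -> exists n : nat,
        has_dim (op_eigenspace (adjoint T \o T) (l ^+ 2)%:C) n /\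
        [set i | s i = l] #= `I_n].

Definition singular_values T : nat -> R :=
  xget (fun=> 0) [set s | is_singular_values T s].

Definition schatten_norm q T : \bar R :=
  ((\sum_(0 <= i <oo) (singular_values T i `^ q)%:E) `^ q^-1)%E.

Definition schatten_class q T : Prop :=
  compact_operator T /\ (schatten_norm q T < +oo)%E.

Definition schatten_numradius q T : \bar R :=
  ereal_sup [set schatten_norm q (re_op (rotate t T)) | t in [set: R]].

End Operators.

(* Main.v *)
(** With X and Y the real and imaginary parts of e^{it}A and r = p/2 < 1, one has
    X^2 + Y^2 = (A^*A + AA^* )/2 and
    X^2 = (A^*A + AA^* )/4 + Re(e^{2it}A^2)/2, while ||X||_p^p = ||X^2||_r^r.
    Both bounds therefore follow from Rotfel'd's inequality
    ||S + T||_r^r <= ||S||_r^r + ||T||_r^r, needed when S and S + T are positive.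
    Since S + T <= S + |T|, the monotonicity of the trace of the r-th power reduces
    it to positive T. For Z = S + T with eigenvectors e_i and eigenvalues l_i,
    tr Z^r = sum_i l_i^(r-1) (<S e_i, e_i> + <T e_i, e_i>). Expanding in
    eigenvectors f_j of S, with eigenvalues m_j, bounds the first sum by
    sum_j m_j <Z^(r-1) f_j, f_j>, and S <= Z gives <Z^-1 f_j, f_j> <= 1/m_j, whence
    <Z^(r-1) f_j, f_j> <= m_j^(r-1) because x^(1-r) is concave. *)

Require Import Defs.
From HB Require Import structures.
From mathcomp Require Import all_boot all_order all_algebra.
From mathcomp Require Import complex ring lra.
From mathcomp Require Import all_classical all_reals all_analysis.

Set Implicit Arguments.
Unset Strict Implicit.
Unset Printing Implicit Defensive.

Import Order.TTheory GRing.Theory Num.Theory.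
Import numFieldNormedType.Exports.

Local Open Scope classical_set_scope.
Local Open Scope ring_scope.

(** The negative powers of [Z] are unbounded, and no functional calculus is set up. They appear only
    inside sums over eigenvectors of index below [N]; since 0 inverted, and 0 to the power r - 1,
    are 0 by convention and [e i = 0] when [l i = 0], such sums ignore the kernel. Only the
    expansion in the other eigenbasis passes to a limit, so each exchange of sums is finite.

    Adjoints and singular values are chosen by [xget]. Hence adjoints are first shown to exist
    (Riesz), compact self-adjoint operators are diagonalized, and the moduli of eigenvalues are
    identified with singular values; Schatten quantities then become sums of powers of eigenvalues.

    In the upper bound the summand Re(e^{2it}A^2)/2 has no sign, which is why Rotfel'd's inequality
    is needed with [T] not positive. In the lower bound Y is itself the real part of a rotation of
    A, so ||X||_p^p and ||Y||_p^p are both at most w_p^p(A); the halves and the absolute value come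
    from max(a, b) = (a + b)/2 + |a - b|/2. *)

Section InnerProduct.
Context {R : realType} {H : completeNormedModType R[i]}.
Variable ip : {dot H for Num.conj}.
Hypothesis hip : norm_from_ip ip.
Implicit Types (x y z : H) (a b : R[i]) (c : R).

Lemma ipC x y : ip x y = (ip y x)^*%C.
Proof. by rewrite hermC expr0 mul1r. Qed.

Lemma ipDl x y z : ip (x + y) z = ip x z + ip y z.
Proof. exact: linearDl. Qed.

Lemma ipDr x y z : ip z (x + y) = ip z x + ip z y.
Proof. exact: linearDr. Qed.

Lemma ipBl x y z : ip (x - y) z = ip x z - ip y z.
Proof. exact: linearBl. Qed.

Lemma ipBr x y z : ip z (x - y) = ip z x - ip z y.
Proof. exact: linearBr. Qed.

Lemma ipZl a x y : ip (a *: x) y = a * ip x y.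
Proof. exact: linearZl_LR. Qed.

Lemma ipZr a x y : ip x (a *: y) = a^*%C * ip x y.
Proof. exact: linearZr_LR. Qed.

Lemma ip0l y : ip 0 y = 0. Proof. exact: linear0l. Qed.

Lemma ip0r y : ip y 0 = 0. Proof. exact: linear0r. Qed.

(** Norms of [H] live in [R[i]]. Squared norms and moduli taken in [R] keep the estimates in an
    ordered field where [lra] and [nra] apply. *)
Definition nsq x : R := complex.Re (ip x x).

Definition csq a : R := complex.Re a ^+ 2 + complex.Im a ^+ 2.

Lemma ip_nsq x : ip x x = (nsq x)%:C%C.
Proof.
have := ipC x x; rewrite /nsq; case: (ip x x) => u v [] /= /eqP.
by rewrite -addr_eq0 -mulr2n mulrn_eq0 /= => /eqP ->.
Qed.

Lemma nsq_ge0 x : 0 <= nsq x.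
Proof. by rewrite -ler0c -ip_nsq; exact: dnorm_ge0. Qed.

Lemma nsq_eq0 x : nsq x = 0 -> x = 0.
Proof.
move=> x0; apply/eqP; rewrite -(dnorm_eq0 ip); apply/eqP.
by rewrite [LHS]ip_nsq x0.
Qed.

Lemma nsq0 : nsq 0 = 0. Proof. by rewrite /nsq ip0l. Qed.

Lemma csq_ge0 a : 0 <= csq a.
Proof. by rewrite addr_ge0 // sqr_ge0. Qed.

Lemma csqE a : a * a^*%C = (csq a)%:C%C.
Proof.
case: a => u v; rewrite /csq /=; apply/eqP; rewrite eq_complex /=.
by apply/andP; split; apply/eqP; ring.
Qed.

Lemma csq_conj a : csq (a^*%C) = csq a.
Proof. by case: a => u v; rewrite /csq /= sqrrN. Qed.

Lemma conjcM a b : (a * b)^*%C = a^*%C * b^*%C.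
Proof. exact: rmorphM. Qed.

Lemma csq_ipC x y : csq (ip x y) = csq (ip y x).
Proof. by rewrite ipC csq_conj. Qed.

Lemma csq0 : csq 0 = 0. Proof. by rewrite /csq /= expr0n addr0. Qed.

Lemma csqM a b : csq (a * b) = csq a * csq b.
Proof. by case: a => u v; case: b => s t; rewrite /csq /=; ring. Qed.

Lemma csq_real c : csq c%:C%C = c ^+ 2.
Proof. by rewrite /csq /= expr0n addr0. Qed.

Lemma nsqN x : nsq (- x) = nsq x.
Proof. by rewrite /nsq -scaleN1r ipZl ipZr rmorphN rmorph1 !mulN1r opprK. Qed.

Lemma nsqBC x y : nsq (x - y) = nsq (y - x).
Proof. by rewrite -nsqN opprB. Qed.

Lemma nsqZ a x : nsq (a *: x) = csq a * nsq x.
Proof. by rewrite {1}/nsq ipZl ipZr mulrA csqE ip_nsq -rmorphM /=. Qed.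

Lemma nsqD x y : nsq (x + y) = nsq x + nsq y + 2 * complex.Re (ip x y).
Proof.
rewrite /nsq ipDl !ipDr (ipC y x).
by case: (ip x x) (ip y y) (ip x y) => ? ? [? ?] [? ?] /=; ring.
Qed.

Lemma nsqB x y : nsq (x - y) = nsq x + nsq y - 2 * complex.Re (ip x y).
Proof.
rewrite nsqD nsqN -scaleN1r ipZr rmorphN rmorph1 mulN1r.
by case: (ip x y) => ? ? /=; ring.
Qed.

Lemma nsqD_le x y : nsq (x + y) <= 2 * nsq x + 2 * nsq y.
Proof. by have := nsq_ge0 (x - y); rewrite nsqB nsqD; lra. Qed.

Lemma nsqB_le x y : nsq (x - y) <= 2 * nsq x + 2 * nsq y.
Proof. by have := nsqD_le x (- y); rewrite nsqN. Qed.

Lemma nsq_norm x : `|x| ^+ 2 = (nsq x)%:C%C.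
Proof. by rewrite hip ip_nsq. Qed.

Lemma norm_lt_nsq x (e : R) : 0 < e -> (`|x| < e%:C%C) = (nsq x < e ^+ 2).
Proof.
move=> e0; rewrite -ltcR rmorphXn /= -nsq_norm ltr_pXn2r // nnegrE ?normr_ge0//.
by rewrite ler0c ltW.
Qed.

Lemma norm_le1 x : (`|x| <= 1) = (nsq x <= 1).
Proof.
rewrite -[in RHS](expr1n _ 2) -lecR rmorphXn /= -nsq_norm ler_pXn2r // nnegrE.
- exact: normr_ge0.
- exact: ler01.
Qed.

Lemma cvg_nsqP (T : Type) (F : set_system T) (FF : Filter F) (f : T -> H) y :
  f t @[t --> F] --> y <->
  (forall e : R, 0 < e -> \forall t \near F, nsq (f t - y) < e).
Proof.
split=> [/cvgrPdist_lt fy e e0|fy].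
  have s0 : (0 : R[i]) < (Num.sqrt e)%:C%C by rewrite ltcR sqrtr_gt0.
  apply: filterS (fy _ s0) => t.
  by rewrite norm_lt_nsq ?sqrtr_gt0 // sqr_sqrtr 1?ltW // nsqBC.
apply/cvgrPdist_lt => e e0.
have eE : e = (complex.Re e)%:C%C by rewrite RRe_real // gtr0_real.
move: e0; rewrite eE ltcR => e0.
have := fy _ (exprn_gt0 2 e0); apply: filterS => t.
by rewrite norm_lt_nsq // nsqBC.
Qed.

Lemma cauchy_nsq (T : Type) (F : set_system T) (FF : ProperFilter F)
    (f : T -> H) :
  (forall e : R, 0 < e ->
    exists2 A, F A & forall s t, A s -> A t -> nsq (f s - f t) < e) ->
  cvg (f t @[t --> F]).
Proof.
move=> fC; apply/cauchy_cvgP/cauchy_exP => e e0.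
have eE : e = (complex.Re e)%:C%C by rewrite RRe_real // gtr0_real.
move: e0; rewrite eE ltcR => e0.
have [A FA hA] := fC _ (exprn_gt0 2 e0).
have [t At] := filter_ex FA.
exists (f t); apply: (@filterS _ F _ _ _ _ FA) => s As.
rewrite /= -ball_normE /ball_ /= norm_lt_nsq //; exact: hA.
Qed.

Lemma cvg_cauchy_nsq (T : Type) (F : set_system T) (FF : ProperFilter F)
    (f : T -> H) (e : R) : 0 < e ->
  cvg (f t @[t --> F]) ->
  exists2 A, F A & forall s t, A s -> A t -> nsq (f s - f t) < e.
Proof.
move=> e0 /cvg_ex[y /(cvg_nsqP _) fy].
have e4 : 0 < e / 4 by rewrite divr_gt0.
exists [set t | nsq (f t - y) < e / 4]; first exact: fy.
move=> s t /= hs ht.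
have -> : f s - f t = (f s - y) - (f t - y) by rewrite opprB addrA subrK.
by apply: le_lt_trans (nsqB_le _ _) _; lra.
Qed.

Lemma csq_Re a : complex.Re a ^+ 2 <= csq a.
Proof. by rewrite /csq lerDl sqr_ge0. Qed.

Lemma eq_csq0 a : csq a = 0 -> a = 0.
Proof.
move/eqP; rewrite /csq paddr_eq0 ?sqr_ge0 // !sqrf_eq0.
by case: a => u v /= /andP[/eqP -> /eqP ->].
Qed.

End InnerProduct.

(** * Bounded, compact and adjoint operators; Cauchy-Schwarz for positive forms *)

Section Operators.
Context {R : realType} {H : completeNormedModType R[i]}.
Variable ip : {dot H for Num.conj}.
Hypothesis hip : norm_from_ip ip.
Implicit Types (x y z : H) (a b : R[i]) (T S : H -> H).

Local Notation nsq := (nsq ip).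
Local Notation rip x y := (complex.Re (ip x y)).

Lemma lin0 T : linear T -> T 0 = 0.
Proof.
move=> hT; have := hT 1 0 0; rewrite !scale1r addr0 => /eqP.
by rewrite -subr_eq0 opprD addNKr oppr_eq0 => /eqP.
Qed.

Lemma linD T x y : linear T -> T (x + y) = T x + T y.
Proof. by move=> hT; have := hT 1 x y; rewrite !scale1r. Qed.

Lemma linZ T a x : linear T -> T (a *: x) = a *: T x.
Proof. by move=> hT; have := hT a x 0; rewrite !addr0 lin0 // addr0. Qed.

Lemma linB T x y : linear T -> T (x - y) = T x - T y.
Proof. by move=> hT; rewrite -scaleN1r linD // linZ // scaleN1r. Qed.

Lemma lin_sum T (I : Type) (r : seq I) (F : I -> H) : linear T ->
  T (\sum_(k <- r) F k) = \sum_(k <- r) T (F k).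
Proof.
move=> hT; elim: r => [|k r IH]; first by rewrite !big_nil lin0.
by rewrite !big_cons linD // IH.
Qed.

Definition is_adj T S := forall x y, ip (T x) y = ip x (S y).

Definition bdd T := exists2 C : R, 0 < C & forall x, nsq (T x) <= C * nsq x.

(* Compactness is used through ultrafilters: sums, compositions and limits are
   then immediate, with no extraction of subsequences. *)
Definition ucompact T := forall U : set_system H,
  UltraFilter U -> U [set x | nsq x <= 1] -> cvg (T x @[x --> U]).

Lemma ip_inj x y : (forall z, ip z x = ip z y) -> x = y.
Proof.
move=> h; apply/eqP; rewrite -subr_eq0; apply/eqP/(nsq_eq0 (ip := ip)).
by rewrite /nsq ipBr h subrr.
Qed.

Lemma is_adj_sym T S : is_adj T S -> is_adj S T.
Proof. by move=> h x y; rewrite ipC -h -ipC. Qed.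

Lemma is_adj_inj T S S' : is_adj T S -> is_adj T S' -> S = S'.
Proof. by move=> h h'; apply/funext => y; apply: ip_inj => z; rewrite -h h'. Qed.

Lemma adjointE T S : is_adj T S -> adjoint ip T = S.
Proof.
move=> h; rewrite /adjoint; case: xgetP => [S' _ hS'|/(_ S)//].
exact: is_adj_inj hS' h.
Qed.

Lemma is_adj_lin T S : is_adj T S -> linear S.
Proof.
move=> h a u v; apply: ip_inj => z.
by rewrite -h ipDr ipZr ipDr ipZr !h.
Qed.

Lemma is_adjD T S T' S' : is_adj T S -> is_adj T' S' ->
  is_adj (fun x => T x + T' x) (fun x => S x + S' x).
Proof. by move=> h h' x y; rewrite ipDl ipDr h h'. Qed.

Lemma is_adjZ T S a : is_adj T S ->
  is_adj (fun x => a *: T x) (fun x => a^*%C *: S x).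
Proof. by move=> h x y; rewrite ipZl ipZr h conjcK. Qed.

Lemma is_adj_comp T S T' S' : is_adj T S -> is_adj T' S' ->
  is_adj (T \o T') (S' \o S).
Proof. by move=> h h' x y; rewrite /= h h'. Qed.

(** The form is nonnegative at x - t c y for every real t, which gives a quadratic in t; the value t
    = 1 / <T y, y> minimizes it. With the identity for [T] this is the usual inequality. *)
Lemma psd_CS T x y : linear T -> is_adj T T -> (forall z, 0 <= rip (T z) z) ->
  csq (ip (T x) y) <= rip (T x) x * rip (T y) y.
Proof.
move=> hT aT pT; set c := ip (T x) y.
have key t : 0 <= rip (T x) x - 2 * t * csq c + t ^+ 2 * csq c * rip (T y) y.
  have := pT (x - (t%:C%C * c) *: y).
  rewrite linB // linZ // !(ipBl, ipBr, ipZl, ipZr) -/c.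
  have -> : ip (T y) x = c^*%C by rewrite aT ipC.
  have := csqE c; rewrite /csq.
  case: c => u v; case: (ip (T x) x) => ? ?; case: (ip (T y) y) => ? ? /= _.
  move=> h; apply: le_trans h _; rewrite le_eqVlt; apply/orP; left; apply/eqP.
  by ring.
have c0 := csq_ge0 c; have x0 := pT x; have y0 := pT y.
have [y1|y1] := eqVneq (rip (T y) y) 0.
  (* Here the quadratic is affine in t, and this t would make it negative unless [csq c = 0]. *)
  have := key ((rip (T x) x + 1) / csq c).
  rewrite y1 !mulr0 addr0.
  have [-> //|c1] := eqVneq (csq c) 0.
  by rewrite -mulrA divfK // mulrDr; lra.
have y2 : 0 < rip (T y) y by rewrite lt_def y1.
have := key ((rip (T y) y)^-1); rewrite -(ler_pM2r y2) mul0r.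
suff -> : (rip (T x) x - 2 * (rip (T y) y)^-1 * csq c +
   (rip (T y) y)^-1 ^+ 2 * csq c * rip (T y) y) * rip (T y) y =
   rip (T x) x * rip (T y) y - csq c by rewrite subr_ge0.
by field.
Qed.

Lemma CS x y : csq (ip x y) <= nsq x * nsq y.
Proof. by apply: (@psd_CS idfun) => // z; exact: nsq_ge0. Qed.

Lemma CS_Re x y : rip x y ^+ 2 <= nsq x * nsq y.
Proof. exact: le_trans (csq_Re _) (CS _ _). Qed.

Lemma cvg_lin_bdd (I : Type) (F : set_system I) (FF : Filter F) (f : I -> H) y T :
  linear T -> bdd T -> f t @[t --> F] --> y -> T (f t) @[t --> F] --> T y.
Proof.
move=> hT [C C0 bT] /(cvg_nsqP hip) fy; apply/(cvg_nsqP hip) => e e0.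
apply: filterS (fy (e / C) (divr_gt0 e0 C0)) => t.
rewrite ltr_pdivlMr // mulrC -linB //; exact: le_lt_trans.
Qed.

Lemma cvg_rip (I : Type) (F : set_system I) (FF : Filter F) (f : I -> H) y z :
  f t @[t --> F] --> y -> rip (f t) z @[t --> F] --> rip y z.
Proof.
move=> /(cvg_nsqP hip) fy; apply/cvgrPdist_lt => e e0.
have z1 : 0 < nsq z + 1 by rewrite ltr_wpDl // nsq_ge0.
apply: filterS (fy (e ^+ 2 / (nsq z + 1)) (divr_gt0 (exprn_gt0 2 e0) z1)) => t.
rewrite ltr_pdivlMr // => h.
rewrite -(ltr_pXn2r (n := 2)) ?nnegrE ?normr_ge0 ?(ltW e0) //.
rewrite real_normK ?num_real //.
have -> : rip y z - rip (f t) z = rip (y - f t) z by rewrite ipBl raddfB.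
apply: le_lt_trans (CS_Re _ _) _; rewrite nsqBC; apply: le_lt_trans h.
by rewrite ler_wpM2l ?nsq_ge0 // lerDl.
Qed.

Lemma ultra_map (I J : Type) (U : set_system I) (f : I -> J) :
  UltraFilter U -> UltraFilter (f @ U).
Proof.
move=> UU; split; first exact: fmap_proper_filter.
move=> G GG UG; rewrite eqEsubset; split => // A GA.
have [//|nA] := in_ultra_setVsetC (f @^-1` A) UU.
have /UG GnA : (f @ U) (~` A) by exact: nA.
by have [z []] := filter_ex (filterI GA GnA).
Qed.

Lemma compact_operator_ucompact T : compact_operator T -> ucompact T.
Proof.
move=> [_]; rewrite precompactE compact_ultra => cT U UU Ub.
have [||y [_ hy]] := cT (T @ U); first exact: ultra_map.
  rewrite /fmap /=; apply: filterS Ub => x /= x1; apply: subset_closure => /=.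
  by exists x => //=; rewrite (norm_le1 hip).
by apply/cvg_ex; exists y.
Qed.

Lemma ucompact_cvg T (I : Type) (U : set_system I) (f : I -> H) (C : R) :
  linear T -> ucompact T -> UltraFilter U -> U [set i | nsq (f i) <= C] ->
  cvg (T (f i) @[i --> U]).
Proof.
move=> hT cT UU UC.
have C1 : 0 < `|C| + 1 by rewrite ltr_wpDl.
pose c := (Num.sqrt (`|C| + 1))%:C%C : R[i].
have c0 : c != 0 by rewrite gt_eqF // ltcR sqrtr_gt0.
have := cT _ (ultra_map (fun i => c^-1 *: f i) UU).
have h : ((fun i => c^-1 *: f i) @ U) [set x | nsq x <= 1].
  rewrite /fmap /=; apply: filterS UC => i /= fi.
  rewrite nsqZ /c -fmorphV csq_real exprVn sqr_sqrtr ?(ltW C1) //.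
  rewrite mulrC ler_pdivrMr // mul1r (le_trans fi) //.
  by rewrite (le_trans (ler_norm _)) // lerDl.
move=> /(_ h) /cvg_ex[y hy]; apply/cvg_ex; exists (c *: y).
have : (c *: T (c^-1 *: f i)) @[i --> U] --> c *: y by apply: cvgZr; exact: hy.
by under eq_fun do rewrite -linZ // scalerA divff // scale1r.
Qed.

(** A substitute for sequences: an ultrafilter containing every [P r] plays the role of points
    chosen in [P r] as r grows. *)
Lemma ultra_filter_from (P : R -> set H) :
  (forall r s, r <= s -> P s `<=` P r) -> (forall r, P r !=set0) ->
  exists2 U : set_system H, UltraFilter U & forall r, U (P r).
Proof.
move=> Pm P0; have : ProperFilter (filter_from [set: R] P).
  apply: filter_from_proper; last by move=> r _.
  apply: filter_from_filter; first by exists 0.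
  move=> r s _ _; exists (Num.max r s) => // x Px.
  by split; [apply: Pm Px | apply: Pm Px]; rewrite le_max lexx ?orbT.
move=> /ultraFilterLemma[U [UU FU]]; exists U => // r.
by apply: FU; exists r.
Qed.

(** Otherwise some ultrafilter on the unit ball makes |T x|^2 exceed every real, while [T x]
    converges along it. *)
Lemma ucompact_bdd T : linear T -> ucompact T -> bdd T.
Proof.
move=> hT cT.
have [[C hC]|hC] := pselect (exists C, forall x, nsq x <= 1 -> nsq (T x) <= C).
  exists (`|C| + 1); first by rewrite ltr_wpDl.
  move=> x; have [x0|x0] := eqVneq (nsq x) 0.
    by rewrite x0 (nsq_eq0 x0) lin0 // nsq0 mulr0.
  have x1 : 0 < nsq x by rewrite lt_def x0 nsq_ge0.
  pose c := (Num.sqrt (nsq x))%:C%C : R[i].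
  have := hC (c^-1 *: x); rewrite linZ // !nsqZ /c -fmorphV csq_real exprVn.
  rewrite sqr_sqrtr ?nsq_ge0 // mulVf // lexx => /(_ isT).
  rewrite mulrC ler_pdivrMr // => h; apply: le_trans h _.
  rewrite ler_wpM2r ?nsq_ge0 //.
  by rewrite (le_trans (ler_norm _)) // lerDl.
exfalso.
have [||U UU Uh] := @ultra_filter_from
    (fun r => [set x | nsq x <= 1 /\ r < nsq (T x)]).
- by move=> r s rs x /= [x1 h]; split => //; exact: le_lt_trans h.
- move=> r; apply: contrapT => h; apply: hC; exists r => x x1.
  by rewrite leNgt; apply/negP => rx; apply: h; exists x.
have /cvg_ex[y /(cvg_nsqP hip) /(_ 1 ltr01) hy] : cvg (T x @[x --> U]).
  by apply: cT; apply: filterS (Uh 0) => x [].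
have [x [/= xy [x1 hx]]] := filter_ex (filterI hy (Uh (2 + 2 * nsq y))).
have := nsqD_le ip (T x - y) y; rewrite subrK; lra.
Qed.

Lemma ucompactD T S : ucompact T -> ucompact S -> ucompact (fun x => T x + S x).
Proof.
by move=> hT hS U UU Ub; apply: is_cvgD; [exact: hT | exact: hS].
Qed.

Lemma ucompactZ T a : ucompact T -> ucompact (fun x => a *: T x).
Proof. by move=> hT U UU Ub; apply: is_cvgZr; exact: hT. Qed.

Lemma ucompact_comp T S : linear T -> ucompact T -> bdd S -> ucompact (T \o S).
Proof.
move=> lT hT [C C0 bS] U UU Ub; apply: (@ucompact_cvg T H U S C) => //.
apply: filterS Ub => x /= x1; apply: le_trans (bS x) _.
by rewrite ler_piMr // ltW.
Qed.

(** |S x|^4 = <T S x, x>^2 is at most C |S x|^2 |x|^2; divide by |S x|^2. *)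
Lemma is_adj_bdd T S : bdd T -> is_adj T S -> bdd S.
Proof.
move=> [C C0 bT] h; exists C => // x.
have [->|Sx0] := eqVneq (nsq (S x)) 0; first by rewrite mulr_ge0 ?nsq_ge0 ?ltW.
have Sx1 : 0 < nsq (S x) by rewrite lt_def Sx0 nsq_ge0.
have := CS_Re (T (S x)) x; rewrite h -/(nsq (S x)) => k.
rewrite -(ler_pM2l Sx1) -expr2 (le_trans k) //.
by rewrite mulrCA mulrA ler_wpM2r ?nsq_ge0.
Qed.

(* [|S (s - t)|^2 = <T S (s - t), s - t>], and [T \o S] is compact. *)
Lemma ucompact_adj T S : linear T -> ucompact T -> is_adj T S -> ucompact S.
Proof.
move=> lT cT h U UU Ub.
have bS := is_adj_bdd (ucompact_bdd lT cT) h.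
have cTS := ucompact_comp lT cT bS.
have lS := is_adj_lin h.
apply: (cauchy_nsq hip) => e e0.
have e1 : 0 < e ^+ 2 / 8 by rewrite divr_gt0 // exprn_gt0.
have [A UA hA] := cvg_cauchy_nsq hip _ e1 (cTS U UU Ub).
exists (A `&` [set x | nsq x <= 1]); first exact: filterI.
move=> s t [As /= s1] [At /= t1].
have := hA s t As At; rewrite /= -!linB // => k.
rewrite -(ltr_pXn2r (n := 2)) ?nnegrE ?nsq_ge0 ?(ltW e0) //.
have := CS_Re (T (S (s - t))) (s - t); rewrite h -/(nsq _) => k2.
apply: le_lt_trans k2 _.
have k3 : nsq (s - t) <= 4 by have := nsqB_le ip s t; lra.
apply: le_lt_trans (ler_wpM2l (nsq_ge0 _ _) k3) _.
have := exprn_gt0 2 e0; lra.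
Qed.

End Operators.

(** * Riesz representation and existence of adjoints *)

Section Riesz.
Context {R : realType} {H : completeNormedModType R[i]}.
Variable ip : {dot H for Num.conj}.
Hypothesis hip : norm_from_ip ip.
Implicit Types (x y z : H) (a b : R[i]) (T S : H -> H).

Local Notation nsq := (nsq ip).
Local Notation rip x y := (complex.Re (ip x y)).

(* A minimizing sequence of [|x|^2 - 2 Re (f x)] is Cauchy by the parallelogram
   identity, and its limit represents [f]. *)
Lemma riesz (f : H -> R[i]) (C : R) :
  (forall a u v, f (a *: u + v) = a * f u + f v) ->
  (forall x, csq (f x) <= C * nsq x) -> exists z, forall x, f x = ip x z.
Proof.
move=> lf bf.
have C1 : 0 < `|C| + 1 by rewrite ltr_wpDl.
pose phi x := nsq x - 2 * complex.Re (f x).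
have f0 : f 0 = 0.
  have := lf 1 0 0; rewrite scale1r addr0 mul1r => /eqP.
  by rewrite -subr_eq0 opprD addNKr oppr_eq0 => /eqP.
have fZ a x : f (a *: x) = a * f x by have := lf a x 0; rewrite f0 !addr0.
have fD u v : f (u + v) = f u + f v by have := lf 1 u v; rewrite scale1r mul1r.
have phib x : - (`|C| + 1) <= phi x.
  have h : complex.Re (f x) ^+ 2 <= (`|C| + 1) * nsq x.
    apply: le_trans (csq_Re _) (le_trans (bf x) _).
    rewrite ler_wpM2r ?nsq_ge0 // (le_trans (ler_norm _)) // lerDl //.
  rewrite /phi; move: h C1 (nsq_ge0 ip x); move: (`|C| + 1) => K.
  move: (complex.Re (f x)) (nsq x) => F N h K0 N0.
  suff : 2 * F <= N + K by lra.
  apply: le_trans (ler_norm _) _.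
  rewrite -(ler_pXn2r (n := 2)) ?nnegrE ?addr_ge0 ?(ltW K0) // real_normK ?num_real //.
  by have := sqr_ge0 (N - K); lra.
have hasinf : has_inf (range phi).
  split; first by exists (phi 0), 0.
  by exists (- (`|C| + 1)) => _ [x _ <-].
set m := inf (range phi).
have mphi x : m <= phi x by apply: ge_inf; [case: hasinf | exists x].
have /choice[X hX] : forall n : nat, exists x, phi x < m + n.+1%:R^-1.
  move=> n; have n0 : (0 : R) < n.+1%:R^-1 by rewrite invr_gt0.
  by have [_ [x _ <-] h] := inf_adherent n0 hasinf; exists x.
have par x y : nsq (x - y) = 2 * (phi x + phi y - 2 * phi ((2^-1 : R)%:C%C *: (x + y))).
  rewrite /phi nsqZ csq_real nsqB nsqD fZ fD.
  by case: (f x) (f y) => ? ? [? ?] /=; field.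
have invs (e : R) : 0 < e -> \forall n \near \oo, n.+1%:R^-1 < e.
  by move=> e0; exact: near_infty_natSinv_lt (PosNum e0).
have : cvg (X n @[n --> \oo]).
  apply: (cauchy_nsq hip) => e e0.
  exists [set n | n.+1%:R^-1 < e / 4]; first by apply: invs; rewrite divr_gt0.
  move=> s t /= hs ht; rewrite par.
  have := mphi ((2^-1 : R)%:C%C *: (X s + X t)); have := hX s; have := hX t.
  move: hs ht; move: (s.+1%:R^-1) (t.+1%:R^-1) => s' t'.
  move: (phi (X s)) (phi (X t)) (phi _) => ps pt pm; lra.
move=> /cvg_ex[z Xz]; exists z.
have key h : complex.Re (f h) = rip z h.
  (* This is phi(z) <= phi(z + t h) expanded. It is obtained from [X n], minimizing up to 1/(n+1),
     with a total error below [e]. *)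
  have ge0 (t : R) : 0 <= t ^+ 2 * nsq h + 2 * t * (rip z h - complex.Re (f h)).
    apply/ler_addgt0Pr => e e0.
    have e2 : 0 < e / 2 by rewrite divr_gt0.
    have t1 : 0 < `|t| + 1 by rewrite ltr_wpDl.
    have e4 : 0 < e / 4 / (`|t| + 1) by rewrite !divr_gt0.
    have Xh : rip (X n) h @[n --> \oo] --> rip z h by exact: cvg_rip.
    have hn : \forall n \near \oo, `|rip z h - rip (X n) h| < e / 4 / (`|t| + 1).
      by move/cvgrPdist_lt : Xh; exact.
    have [n [/= hn1 hn2]] := filter_ex (filterI hn (invs _ e2)).
    have := mphi (X n + t%:C%C *: h).
    rewrite {1}/phi nsqD nsqZ csq_real fD fZ ipZr conjc_real.
    have := hX n; rewrite {1}/phi.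
    have : 2 * t * (rip (X n) h - rip z h) <= e / 2.
      apply: le_trans (ler_norm _) _.
      rewrite !normrM ger0_norm // -mulrA distrC.
      have : `|t| * `|rip z h - rip (X n) h| <= e / 4; last by lra.
      move: hn1; rewrite ltr_pdivlMr // => hn1.
      by have := normr_ge0 (rip z h - rip (X n) h); nra.
    case: (f (X n)) (ip (X n) h) (ip z h) (f h) => ? ? [? ?] [? ?] [? ?] /=.
    by move: hn2; move: (n.+1%:R^-1) => n'; lra.
  set D := rip z h - complex.Re (f h).
  apply/eqP; rewrite eq_sym -subr_eq0 -/D.
  have [N0|N0] := eqVneq (nsq h) 0.
    have := ge0 (- D); rewrite N0 -/D mulr0 add0r => h1.
    by rewrite -sqrf_eq0 eq_le sqr_ge0 andbT; move: h1; nra.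
  have N1 : 0 < nsq h by rewrite lt_def N0 nsq_ge0.
  (* The minimizer in t of t^2 |h|^2 + 2 t D; the minimum is -D^2 / |h|^2, so D = 0. *)
  have := ge0 (- D / nsq h); rewrite -/D.
  rewrite -(pmulr_lge0 _ N1).
  have -> : ((- D / nsq h) ^+ 2 * nsq h + 2 * (- D / nsq h) * D) * nsq h = - D ^+ 2.
    by field.
  by rewrite oppr_ge0 -sqrf_eq0 => h1; rewrite eq_le h1 sqr_ge0.
(* Real parts agree everywhere; evaluating at i x recovers the imaginary parts. *)
move=> x; have h1 := key x; have := key ('i%C *: x).
rewrite fZ (ipC ip z) ipZl; move: h1; rewrite (ipC ip z x).
case: (f x) (ip x z) => ? ? [? ?] /= ->.
by rewrite !mul0r !sub0r !mul1r => /oppr_inj ->.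
Qed.

Lemma adj_exists T : linear T -> bdd ip T -> exists S, is_adj ip T S.
Proof.
move=> lT [C C0 bT].
have /choice[S hS] : forall y, exists z, forall x, ip (T x) y = ip x z.
  move=> y; apply: (@riesz _ (C * nsq y)).
    by move=> a u v; rewrite lT ipDl ipZl.
  move=> x; apply: le_trans (CS _ _ _) _.
  by rewrite mulrAC ler_wpM2r ?nsq_ge0.
by exists S => x y.
Qed.

End Riesz.

(** * Spectral theorem for compact self-adjoint operators *)

Section Spectral.
Context {R : realType} {H : completeNormedModType R[i]}.
Variable ip : {dot H for Num.conj}.
Hypothesis hip : norm_from_ip ip.
Implicit Types (x y z : H) (a b : R[i]) (T S : H -> H).

Local Notation nsq := (nsq ip).
Local Notation rip x y := (complex.Re (ip x y)).

Definition compact_selfadj T := [/\ linear T, ucompact ip T & is_adj ip T T].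

(* [e] is orthonormal except that [e i = 0] where [l i = 0], so that a
   finite-rank operator also has an infinite system. The fourth clause encodes
   completeness: [T] has norm at most [`|l n|] on the complement of the first
   [n] vectors. *)
Definition eigensystem T (e : nat -> H) (l : nat -> R) :=
  [/\ forall i, T (e i) = (l i)%:C%C *: e i,
      forall i j, ip (e i) (e j) = ((i == j) && (l i != 0))%:R,
      forall i j, (i <= j)%N -> `|l j| <= `|l i|,
      forall n x, (forall i, (i < n)%N -> ip x (e i) = 0) ->
        nsq (T x) <= l n ^+ 2 * nsq x
    & l n @[n --> \oo] --> 0].

Lemma cvg_ip0 (I : Type) (F : set_system I) (FF : ProperFilter F)
    (f : I -> H) y w :
  f t @[t --> F] --> y -> F [set t | ip (f t) w = 0] -> ip y w = 0.
Proof.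
move=> /(cvg_nsqP hip) fy Fw; apply: eq_csq0; apply/eqP.
rewrite eq_le csq_ge0 andbT; apply/ler_addgt0Pr => e e0; rewrite add0r.
have w1 : 0 < nsq w + 1 by rewrite ltr_wpDl // nsq_ge0.
have [t [/= h tw]] := filter_ex (filterI (fy _ (divr_gt0 e0 w1)) Fw).
have -> : ip y w = ip (y - f t) w by rewrite ipBl tw subr0.
apply: le_trans (CS _ _ _) _; rewrite nsqBC.
move: h; rewrite ltr_pdivlMr // => h; apply: le_trans (ltW h).
by rewrite ler_wpM2l ?nsq_ge0 // lerDl.
Qed.

(* If [x] nearly maximizes [|T x|^2], with supremum [M], on the unit ball of the
   invariant subspace [V] orthogonal to [E], then [|T (T x) - M x|^2] is at
   most [M (M - |T x|^2)]; so a limit [y] of [T x] satisfies [T (T y) = M y],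
   and [y] or [T y + sqrt M y] is an eigenvector of [T]. *)
Lemma max_eigenvector T (E : set H) : compact_selfadj T ->
  (forall w, E w -> exists a, T w = a *: w) ->
  exists u (l : R),
  [/\ forall w, E w -> ip u w = 0,
      T u = l%:C%C *: u,
      nsq u = (l != 0)%:R
    & forall x, (forall w, E w -> ip x w = 0) -> nsq (T x) <= l ^+ 2 * nsq x].
Proof.
move=> [lT cT aT] ET.
pose V x := forall w, E w -> ip x w = 0.
have VZ a x : V x -> V (a *: x) by move=> Vx w Ew; rewrite ipZl Vx // mulr0.
have VD x y : V x -> V y -> V (x + y).
  by move=> Vx Vy w Ew; rewrite ipDl Vx // Vy // addr0.
have VT x : V x -> V (T x).
  by move=> Vx w Ew; have [a aw] := ET w Ew; rewrite aT aw ipZr Vx // mulr0.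
have bT := ucompact_bdd hip lT cT.
have [C C0 bTC] := bT.
pose B := [set nsq (T x) | x in [set x | V x /\ nsq x <= 1]].
have B0 : B 0.
  exists 0; last by rewrite lin0 // nsq0.
  by split; [move=> w _; rewrite ip0l | rewrite nsq0 ler01].
have hasB : has_sup B.
  split; first by exists 0.
  exists C => _ [x [Vx x1] <-]; apply: le_trans (bTC x) _.
  by rewrite ler_piMr // ltW.
pose M := sup B.
have M0 : 0 <= M by apply: sup_upper_bound.
have TM x : V x -> nsq (T x) <= M * nsq x.
  move=> Vx; have [x0|x0] := eqVneq (nsq x) 0.
    by rewrite x0 mulr0 (nsq_eq0 x0) lin0 // nsq0.
  have x1 : 0 < nsq x by rewrite lt_def x0 nsq_ge0.
  pose c := (Num.sqrt (nsq x))%:C%C : R[i].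
  have cc : csq c^-1 = (nsq x)^-1.
    by rewrite /c -fmorphV csq_real exprVn sqr_sqrtr ?nsq_ge0.
  have : nsq (T (c^-1 *: x)) <= M.
    apply: sup_upper_bound => //; exists (c^-1 *: x) => //; split; first exact: VZ.
    by rewrite nsqZ cc mulVf.
  by rewrite linZ // nsqZ cc mulrC ler_pdivrMr.
(* [T] vanishes on the complement, and the zero vector with eigenvalue 0 is returned: this pads the
   system when the rank is finite. *)
have [M00|M00] := eqVneq M 0.
  exists 0, 0; split.
  - by move=> w _; rewrite ip0l.
  - by rewrite lin0 // scaler0.
  - by rewrite nsq0 eqxx.
  - by move=> x Vx; have := TM x Vx; rewrite M00 expr2 !mul0r.
have M1 : 0 < M by rewrite lt_def M00.
(* The tolerance [expR (- r)] turns a real index into an error decreasing to 0, so the sets of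
   near-maximizers are nested as required. *)
have [||U UU Uh] := @ultra_filter_from R H
    (fun r => [set x | [/\ V x, nsq x <= 1 & M - expR (- r) < nsq (T x)]]).
- move=> r s rs x /= [Vx x1 h]; split => //; apply: le_lt_trans h.
  by rewrite lerD2l lerN2 ler_expR lerN2.
- move=> r; have [_ [x [Vx x1] <-] h] := sup_adherent (expR_gt0 (- r)) hasB.
  by exists x.
have Ue (e : R) : 0 < e ->
    U [set x | [/\ V x, nsq x <= 1 & M - e < nsq (T x)]].
  by move=> e0; have := Uh (- ln e); rewrite opprK lnK.
have /cvg_ex[y Ty] : cvg (T x @[x --> U]).
  by apply: cT; apply: filterS (Uh 0) => x [].
have Vy : V y.
  move=> w Ew; apply: cvg_ip0 Ty _; apply: filterS (Uh 0) => x [Vx _ _].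
  exact: VT.
have y0 : y != 0.
  apply/negP => /eqP y0; move: Ty; rewrite y0 => /(cvg_nsqP hip) Ty.
  have M2 : 0 < M / 2 by rewrite divr_gt0.
  have [x [/= + [_ _]]] := filter_ex (filterI (Ty _ M2) (Ue _ M2)).
  by rewrite subr0; lra.
have TTy : T (T y) = M%:C%C *: y.
  have TTTx : T (T (T x)) @[x --> U] --> T (T y).
    by apply: (cvg_lin_bdd hip) => //; apply: (cvg_lin_bdd hip).
  have MTx : M%:C%C *: T x @[x --> U] --> M%:C%C *: y by exact: cvgZr.
  (* Along [U] only [T x] is known to converge, not [x]. Hence [T] is applied once more, which costs
     the factor [C] in [e / (C * M)]. *)
  have D0 : (T (T (T x)) - M%:C%C *: T x) @[x --> U] --> (0 : H).
    apply/(cvg_nsqP hip) => e e0.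
    have e1 : 0 < e / (C * M) by rewrite divr_gt0 // mulr_gt0.
    apply: filterS (Ue _ e1) => x [Vx x1 hx].
    rewrite subr0 -linZ // -linB //; apply: le_lt_trans (bTC _) _.
    move: hx; rewrite ltrBlDl -ltrBlDr ltr_pdivlMr ?mulr_gt0 // => hx.
    apply: le_lt_trans hx; rewrite mulrCA ler_pM2l //.
    rewrite nsqB nsqZ csq_real ipZr conjc_real aT.
    have := TM _ (VT _ Vx).
    rewrite (_ : complex.Re (M%:C%C * ip (T x) (T x)) = M * nsq (T x)); last first.
      by rewrite /nsq; case: (ip (T x) (T x)) => ? ? /=; rewrite mul0r subr0.
    by have := nsq_ge0 ip (T x); move: M1 x1; nra.
  have D1 : (T (T (T x)) - M%:C%C *: T x) @[x --> U] --> T (T y) - M%:C%C *: y.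
    exact: cvgB.
  apply/eqP; rewrite -subr_eq0; apply/eqP.
  exact: (cvg_unique (@norm_hausdorff _ H) D1 D0).
pose m := Num.sqrt M.
have m2 : m ^+ 2 = M by rewrite sqr_sqrtr.
have m0 : m != 0 by rewrite gt_eqF // sqrtr_gt0.
have fin u (l : R) : V u -> u != 0 -> T u = l%:C%C *: u -> l ^+ 2 = M ->
  exists u (l : R),
  [/\ forall w, E w -> ip u w = 0,
      T u = l%:C%C *: u,
      nsq u = (l != 0)%:R
    & forall x, (forall w, E w -> ip x w = 0) -> nsq (T x) <= l ^+ 2 * nsq x].
  move=> Vu u0 Tu l2.
  have nu : 0 < nsq u.
    rewrite lt_def nsq_ge0 andbT; apply: contra_neq u0; exact: nsq_eq0.
  pose c := (Num.sqrt (nsq u))%:C%C : R[i].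
  exists (c^-1 *: u), l; split.
  - exact: VZ.
  - by rewrite linZ // Tu scalerA mulrC -scalerA.
  - rewrite nsqZ /c -fmorphV csq_real exprVn sqr_sqrtr ?nsq_ge0 //.
    by rewrite -sqrf_eq0 l2 M00 mulVf // gt_eqF.
  - by move=> x Vx; rewrite l2; exact: TM.
have [v0|v0] := eqVneq (T y + m%:C%C *: y) 0.
  apply: (fin y (- m)) => //; last by rewrite sqrrN.
  by apply/eqP; rewrite rmorphN scaleNr -addr_eq0 v0.
apply: (fin _ m _ v0) => //; first by apply: VD; [exact: VT | exact: VZ].
rewrite linD // linZ // TTy scalerDr scalerA -rmorphM /= -expr2 m2.
by rewrite addrC.
Qed.

(** Eigenvectors are picked greedily, each of maximal |eigenvalue| on the complement of the earlier
    ones; compactness forces the eigenvalues to 0. *)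
Lemma spectral T : compact_selfadj T -> exists e l, eigensystem T e l.
Proof.
move=> sT; have [lT cT aT] := sT.
pose E (s : seq (H * R)) := [set u | exists2 i, (i < size s)%N & u = (nth (0, 0) s i).1].
pose good (p : H * R) := T p.1 = p.2%:C%C *: p.1.
(* Each choice depends on all earlier vectors, so the history is carried as a list. The choice
   function is total: its specification is conditional on a history of eigenpairs, which strong
   induction then supplies. *)
have /choice[step hstep] : forall s, exists p : H * R,
    (forall i, (i < size s)%N -> good (nth (0, 0) s i)) ->
  [/\ forall w, E s w -> ip p.1 w = 0, good p, nsq p.1 = (p.2 != 0)%:R
    & forall x, (forall w, E s w -> ip x w = 0) -> nsq (T x) <= p.2 ^+ 2 * nsq x].
  move=> s.
  have [gs|ngs] := pselect (forall i, (i < size s)%N -> good (nth (0, 0) s i)).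
    have [||u [l hul]] := @max_eigenvector T (E s) => //.
      by move=> w [i si ->]; exists (nth (0, 0) s i).2%:C%C; exact: gs.
    by exists (u, l).
  by exists (0, 0) => /ngs.
pose s := fix s n := if n is n'.+1 then rcons (s n') (step (s n')) else [::].
pose p n := step (s n).
have sE n : s n = mkseq p n.
  by elim: n => //= n IH; rewrite mkseqS -IH.
have gp n : good (p n).
  elim/ltn_ind: n => n IH.
  have [|//] := hstep (s n).
  rewrite sE size_mkseq => i lt_in; rewrite nth_mkseq //; exact: IH.
pose e n := (p n).1; pose l n := (p n).2.
have orthE n x : (forall i, (i < n)%N -> ip x (e i) = 0) ->
    forall w, E (s n) w -> ip x w = 0.
  by move=> h w [k]; rewrite sE size_mkseq => lt_in ->; rewrite nth_mkseq //; exact: h.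
have hp n : [/\ forall i, (i < n)%N -> ip (e n) (e i) = 0, nsq (e n) = (l n != 0)%:R
    & forall x, (forall i, (i < n)%N -> ip x (e i) = 0) -> nsq (T x) <= l n ^+ 2 * nsq x].
  have [|h1 h2 h3 h4] := hstep (s n).
    by rewrite sE size_mkseq => i lt_in; rewrite nth_mkseq //; exact: gp.
  split => //.
    by move=> i lt_in; apply: h1; exists i; rewrite sE ?size_mkseq // nth_mkseq.
  by move=> x hx; apply: h4; exact: orthE.
have E1 i : T (e i) = (l i)%:C%C *: e i by exact: gp.
have E2 i j : ip (e i) (e j) = ((i == j) && (l i != 0))%:R.
  have [->|ij] := eqVneq i j.
    by have [_ h _] := hp j; rewrite ip_nsq h /= rmorph_nat.
  case: (ltngtP i j) ij => // ij _.
    by rewrite (ipC ip); have [h _ _] := hp j; rewrite h // conjc0.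
  by have [h _ _] := hp i; rewrite h.
have nsqe i : nsq (e i) = (l i != 0)%:R by have [] := hp i.
have E3 i j : (i <= j)%N -> `|l j| <= `|l i|.
  move=> ij; have [->|lj] := eqVneq (l j) 0; first by rewrite normr0.
  have [_ _ h] := hp i.
  have := h (e j); rewrite E1 nsqZ csq_real nsqe lj !mulr1.
  rewrite -[l j ^+ 2]real_normK ?num_real // -[l i ^+ 2]real_normK ?num_real //.
  rewrite ler_pXn2r ?nnegrE //; apply => k ki; rewrite E2.
  by rewrite gtn_eqF // (leq_trans ki).
exists e, l; split => //.
  by move=> n x; have [_ _] := hp n; exact.
have [h|] := pselect (forall d : R, 0 < d -> exists n, `|l n| < d).
  apply/cvgrPdist_lt => d d0; have [N hN] := h d d0.
  exists N => // n /= Nn; rewrite sub0r normrN.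
  exact: le_lt_trans (E3 _ _ Nn) hN.
move=> /existsNP[d /not_implyP[d0 hd]]; exfalso.
have ld n : d <= `|l n| by rewrite leNgt; apply/negP => k; apply: hd; exists n.
have l0 n : l n != 0 by rewrite -normr_gt0 (lt_le_trans d0).
have [U [UU FU]] := ultraFilterLemma eventually_filter.
have /(cvg_cauchy_nsq hip _ (exprn_gt0 2 d0)) : cvg (T (e n) @[n --> U]).
  apply: (ucompact_cvg (ip := ip) (C := 1)) => //.
  by apply: filterS filterT => n _ /=; rewrite nsqe l0.
move=> [A UA hA].
(* [U] contains all tails, so [A] holds two indices t < r. By orthogonality |T e_r - T e_t|^2 =
   l_r^2 + l_t^2 >= 2 d^2, against the Cauchy bound d^2. *)
have [t At] := filter_ex UA.
have Ut : U [set n | (t < n)%N] by apply: FU; exists t.+1.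
have [r [Ar /= tr]] := filter_ex (filterI UA Ut).
have := hA r t Ar At; rewrite !E1 nsqB !nsqZ !csq_real !nsqe !l0 !mulr1.
rewrite ipZl ipZr E2 gtn_eqF //= !mulr0 /=.
rewrite -[l r ^+ 2]real_normK ?num_real // -[l t ^+ 2]real_normK ?num_real //.
have := ld r; have := ld t; move: d0; move: (`|l r|) (`|l t|) => u v.
by nra.
Qed.

End Spectral.

(** * Uniqueness of singular values and their computation from an eigensystem *)

Section SingularValues.
Context {R : realType} {H : completeNormedModType R[i]}.
Variable ip : {dot H for Num.conj}.
Hypothesis hip : norm_from_ip ip.
Implicit Types (x y z : H) (a b : R[i]) (T S : H -> H).

Local Notation nsq := (nsq ip).

Lemma ip_suml (I : Type) (r : seq I) (F : I -> H) y :
  ip (\sum_(i <- r) F i) y = \sum_(i <- r) ip (F i) y.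
Proof.
elim: r => [|k r IH]; first by rewrite !big_nil ip0l.
by rewrite !big_cons ipDl IH.
Qed.

(** Independence makes the matrix of the [e i] in terms of the [e' j] row free, so its rank [n] is
    at most its number [m] of columns. *)
Lemma has_dim_le (V : set H) n m : has_dim V n -> has_dim V m -> (n <= m)%N.
Proof.
move=> [e [eF eV]] [e' [_ e'V]].
have ein i : V (e i).
  rewrite eV; exists (fun j => (j == i)%:R) => //=.
  rewrite (bigD1 i) //= eqxx scale1r big1 ?addr0 // => j /negPf ->.
  by rewrite scale0r.
have /choice[A hA] : forall i, exists c : 'I_m -> R[i], \sum_j c j *: e' j = e i.
  by move=> i; have := ein i; rewrite e'V => -[c _ <-]; exists c.
pose M := \matrix_(i, j) A i j.
suff /eqP <- : row_free M by exact: rank_leq_col.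
apply: inj_row_free => v vM; apply/rowP => i; rewrite mxE.
apply: (eF (fun i => v 0 i)).
under eq_bigr do rewrite -hA scaler_sumr.
rewrite exchange_big /= big1 // => j _.
under eq_bigr do rewrite scalerA.
rewrite -scaler_suml (_ : \sum_i v 0 i * A i j = (v *m M) 0 j).
  by rewrite vM mxE scale0r.
by rewrite mxE; apply: eq_bigr => k _; rewrite mxE.
Qed.

(* If [s i > s' i] while [s] and [s'] agree before [i], then the level set of
   [s i] is strictly larger for [s] than for [s']. *)
Lemma is_singular_values_le T (s s' : nat -> R) :
  is_singular_values ip T s -> is_singular_values ip T s' ->
  forall i, (forall j, (j < i)%N -> s j = s' j) -> s i <= s' i.
Proof.
move=> [_ _ cs] [s'n s'0 cs'] i ss'; rewrite leNgt; apply/negP => ssi.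
have si : 0 < s i by apply: le_lt_trans ssi.
have [n [dn sn]] := cs _ si; have [m [dm sm]] := cs' _ si.
have nm : n = m by apply/eqP; rewrite eqn_leq !(has_dim_le dn dm, has_dim_le dm dn).
subst m.
pose A := [set j | s j = s i]; pose B := [set j | s' j = s i].
have fA : finite_set A by exists n.
have fB : finite_set B by exists n.
have BA : B `<=` A.
  move=> j /= Bj; rewrite /A /= ss' // ltnNge; apply/negP => ij.
  by move: ssi; rewrite -Bj ltNge s'n.
have : finmap.fproper (fset_set B) (fset_set A).
  rewrite finmap.fproperE; apply/andP; split; first by rewrite -fset_set_sub.
  apply/negP; rewrite -fset_set_sub // => /(_ i erefl) /= s'i.
  by rewrite s'i ltxx in ssi.
by move=> /finmap.fproper_ltn_card; rewrite (card_fset_set sn) (card_fset_set sm) ltnn.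
Qed.

Lemma is_singular_values_inj T (s s' : nat -> R) :
  is_singular_values ip T s -> is_singular_values ip T s' -> s = s'.
Proof.
move=> hs hs'; apply/funext; elim/ltn_ind => i IH.
apply/eqP; rewrite eq_le (is_singular_values_le hs hs') //.
by rewrite (is_singular_values_le hs' hs) // => j ji; rewrite IH.
Qed.

Lemma singular_valuesE T s : is_singular_values ip T s -> singular_values ip T = s.
Proof.
move=> hs; rewrite /singular_values; case: xgetP => [s' _ hs'|/(_ s)//].
exact: is_singular_values_inj hs' hs.
Qed.

Section EigData.
Variables (T : H -> H) (e : nat -> H) (l : nat -> R).
Hypothesis lT : linear T.
Hypothesis aT : is_adj ip T T.
Hypothesis eT : eigensystem ip T e l.

Lemma eig_scale0 i : l i = 0 -> e i = 0.
Proof.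
have [_ h _ _ _] := eT; move=> li; apply: (nsq_eq0 (ip := ip)).
by rewrite /nsq h eqxx li eqxx.
Qed.

Definition resid n x := x - \sum_(k < n) ip x (e k) *: e k.

Lemma ip_resid n x k : l k != 0 -> ip (resid n x) (e k) = if (k < n)%N then 0 else ip x (e k).
Proof.
have [_ h _ _ _] := eT => lk; rewrite /resid ipBl ip_suml.
case: ltnP => [kn|nk].
  rewrite (bigD1 (Ordinal kn)) //= ipZl h eqxx lk mulr1 big1 ?addr0 ?subrr //.
  by move=> j jk; rewrite ipZl h (_ : (j == k :> nat) = false) ?mulr0 //; apply: negbTE.
rewrite big1 ?subr0 // => j _; rewrite ipZl h ltn_eqF ?mulr0 //.
exact: leq_trans nk.
Qed.

Lemma ip_resid0 n x k : (k < n)%N -> ip (resid n x) (e k) = 0.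
Proof.
move=> kn; have [lk|lk] := eqVneq (l k) 0.
  by rewrite eig_scale0 // ip0r.
by rewrite ip_resid // kn.
Qed.

(** Eigenvectors of the self-adjoint [T \o T] for distinct eigenvalues d^2 and (l k)^2 are
    orthogonal. *)
Lemma eig_coef x (d : R) k : T (T x) = (d ^+ 2)%:C%C *: x -> 0 < d ->
  `|l k| != d -> ip x (e k) = 0.
Proof.
have [h1 _ _ _ _] := eT => TTx d0 lkd.
have : ip (T (T x)) (e k) = ip x (T (T (e k))) by rewrite !aT.
rewrite TTx h1 (linZ _ _ lT) h1 scalerA -rmorphM ipZl ipZr conjc_real /= => /eqP.
rewrite -subr_eq0 -mulrBl mulf_eq0 => /orP[|/eqP //].
rewrite -rmorphB /= -[0]/(0%:C%C) (inj_eq (@complexI _)) subr_eq0 -expr2.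
rewrite -[l k ^+ 2]real_normK ?num_real // eqrXn2 ?(ltW d0) //.
by rewrite eq_sym (negPf lkd).
Qed.

(** As [l] tends to 0, finitely many [k] have [|l k| = d]; their [e k] form a basis of the
    d^2-eigenspace of [T \o T], which merges the eigenvalues d and -d of [T]. *)
Lemma eig_is_singular_values : is_singular_values ip T (fun i => `|l i|).
Proof.
have [h1 h2 h3 h4 h5] := eT; split => //.
move=> d d0; rewrite (adjointE aT).
have [N hN] : exists N, forall n, (N <= n)%N -> `|l n| < d.
  move/cvgrPdist_lt : h5 => /(_ d d0) [N _ hN]; exists N => n /hN.
  by rewrite /= sub0r normrN.
pose s := [seq k <- iota 0 N | `|l k| == d].
have us : uniq s by rewrite filter_uniq // iota_uniq.
have ms k : (k \in s) = (`|l k| == d).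
  rewrite mem_filter mem_iota add0n /=; case: eqP => //= lk.
  by rewrite ltnNge; apply/negP => /hN; rewrite lk ltxx.
have ls k : k \in s -> l k != 0 by rewrite ms -normr_eq0 => /eqP ->; rewrite gt_eqF.
have lsd k : k \in s -> l k ^+ 2 = d ^+ 2.
  by rewrite ms => /eqP <-; rewrite real_normK // num_real.
have nths (i : 'I_(size s)) : nth 0%N s i \in s by exact: mem_nth.
exists (size s); split; last first.
  rewrite card_eq_sym; apply/card_set_bijP; exists (nth 0%N s); split.
  - by move=> i /= si; apply/eqP; rewrite -ms mem_nth.
  - by move=> i j /[!inE] /= si sj /eqP; rewrite nth_uniq // => /eqP.
  - move=> k /= /eqP; rewrite -ms => ks; exists (index k s) => /=.
      by rewrite index_mem.
    by rewrite nth_index.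
exists (fun i : 'I_(size s) => e (nth 0%N s i)); split.
  move=> c c0 i; have := congr1 (fun x => ip x (e (nth 0%N s i))) c0.
  rewrite ip_suml ip0l (bigD1 i) //= ipZl h2 eqxx ls // mulr1.
  rewrite big1 ?addr0 // => j ji; rewrite ipZl h2 nth_uniq //.
  by rewrite (negPf (ji : (j != i :> nat))) mulr0.
apply/seteqP; split => [x /= TTx|x /= [c _ <-]].
  have {}TTx : T (T x) = (d ^+ 2)%:C%C *: x := TTx.
  exists (fun i => ip x (e (nth 0%N s i))) => //=.
  transitivity (\sum_(k < N) ip x (e k) *: e k).
    rewrite -(big_mkord xpredT (fun k => ip x (e k) *: e k)) /index_iota subn0.
    rewrite (bigID (fun k => `|l k| == d)) /= [X in _ + X]big1 ?addr0.
      by rewrite -[RHS]big_filter -/s [RHS](big_nth 0%N) big_mkord.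
    by move=> k lk; rewrite (eig_coef TTx) // scale0r.
  apply/eqP; rewrite eq_sym -subr_eq0; apply/eqP.
  (* The residual is again in the eigenspace, so |T r| = d |r|; being orthogonal to the first [N]
     vectors it has |T r| <= |l N| |r| with |l N| < d. Hence r = 0. *)
  rewrite -/(resid N x); set r := resid N x.
  have TTr : T (T r) = (d ^+ 2)%:C%C *: r.
    rewrite /r /resid !(linB _ _ lT) !(lin_sum _ _ lT) TTx scalerBr scaler_sumr.
    congr (_ - _); apply: eq_bigr => k _.
    have [lk|lk] := eqVneq `|l k| d.
      rewrite !(linZ _ _ lT) !h1 (linZ _ _ lT) h1 !scalerA -lk real_normK ?num_real //.
      by rewrite expr2 rmorphM /= [in RHS]mulrC mulrA.
    by rewrite (eig_coef TTx) // !scale0r !(lin0 lT) scaler0.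
  have := h4 N r (fun i => @ip_resid0 N x i).
  rewrite {1}/nsq aT TTr ipZr conjc_real ip_nsq -rmorphM /=.
  have [//|r0] := eqVneq r 0.
  have r1 : 0 < nsq r.
    by rewrite lt_def nsq_ge0 andbT; apply: contra_neq r0; exact: nsq_eq0.
  rewrite ler_pM2r // -[l N ^+ 2]real_normK ?num_real //.
  by rewrite ler_pXn2r ?nnegrE ?(ltW d0) // leNgt hN.
rewrite /op_eigenspace /= scaler_sumr !(lin_sum _ _ lT); apply: eq_bigr => i _.
rewrite !(linZ _ _ lT) !h1 (linZ _ _ lT) h1 !scalerA -mulrA -rmorphM -expr2 /=.
by rewrite -(lsd _ (nths i)) mulrC.
Qed.

End EigData.

End SingularValues.

(** * Bessel's inequality, quadratic forms and Schatten sums in an eigensystem *)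

Section Expansion.
Context {R : realType} {H : completeNormedModType R[i]}.
Variable ip : {dot H for Num.conj}.
Hypothesis hip : norm_from_ip ip.
Implicit Types (x y z : H) (a b : R[i]) (S : H -> H).

Local Notation nsq := (nsq ip).
Local Notation rip x y := (complex.Re (ip x y)).

Lemma ip_sumr (I : Type) (r : seq I) (F : I -> H) y :
  ip y (\sum_(i <- r) F i) = \sum_(i <- r) ip y (F i).
Proof.
elim: r => [|k r IH]; first by rewrite !big_nil ip0r.
by rewrite !big_cons ipDr IH.
Qed.

Lemma rip_is_adj S S' : linear S ->
  (forall x y, rip (S x) y = rip x (S' y)) -> is_adj ip S S'.
Proof.
move=> lS h x y; have h1 := h x y; have := h ('i%C *: x) y.
rewrite (linZ _ _ lS) !ipZl; move: h1.
case: (ip (S x) y) (ip x (S' y)) => u v [u' v'] /= ->.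
by rewrite !mul0r !mul1r !sub0r => /oppr_inj ->.
Qed.

Lemma nsq_lim_le (I : Type) (F : set_system I) (FF : ProperFilter F)
    (f : I -> H) y (B : R) :
  f t @[t --> F] --> y -> F [set t | nsq (f t) <= B] -> nsq y <= B.
Proof.
move=> fy FB.
have h : rip (f t) y @[t --> F] --> nsq y by exact: cvg_rip.
(* From 2 Re <f t, y> <= |f t|^2 + |y|^2, passing to the limit on the left only. *)
suff : nsq y <= (B + nsq y) / 2 by lra.
apply: (cvgr_to_le h); apply: filterS FB => t /= ftB.
by have := nsq_ge0 ip (f t - y); rewrite nsqB; lra.
Qed.

Variables (T : H -> H) (e : nat -> H) (l : nat -> R).
Hypothesis lT : linear T.
Hypothesis aT : is_adj ip T T.
Hypothesis eT : eigensystem ip T e l.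

Local Notation w x k := (csq (ip x (e k))).

Lemma eig_nsq_sum m n (c : nat -> R[i]) :
  nsq (\sum_(m <= k < n) c k *: e k) = \sum_(m <= k < n) csq (c k) * nsq (e k).
Proof.
have [_ h _ _ _] := eT.
have [mn|/ltnW nm] := leqP m n; last by rewrite !big_geq // nsq0.
elim: n mn => [|n IH]; first by rewrite leqn0 => /eqP ->; rewrite !big_geq // nsq0.
rewrite leq_eqVlt => /orP[/eqP ->|mn]; first by rewrite !big_geq // nsq0.
rewrite !big_nat_recr //= nsqD IH // nsqZ ip_suml.
suff -> : \sum_(m <= k < n) ip (c k *: e k) (c n *: e n) = 0.
  by rewrite mulr0 addr0.
rewrite big_nat big1 // => k /andP[_ kn].
by rewrite ipZl ipZr h ltn_eqF // !mulr0.
Qed.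

Lemma eig_nsqe k : nsq (e k) = (l k != 0)%:R.
Proof. by have [_ h _ _ _] := eT; rewrite /nsq h eqxx; case: (_ != _). Qed.

Lemma eig_nsqe_le k : nsq (e k) <= 1.
Proof. by rewrite eig_nsqe lern1 leq_b1. Qed.

Lemma ip_resid_sum n x c :
  ip (resid ip e n x) (\sum_(k < n) c k *: e k) = 0.
Proof.
rewrite ip_sumr big1 // => k _; rewrite ipZr (ip_resid0 eT) ?mulr0 //.
Qed.

Lemma resid_split n x : x = \sum_(k < n) ip x (e k) *: e k + resid ip e n x.
Proof. by rewrite /resid addrC subrK. Qed.

Lemma w_nsqe x k : w x k * nsq (e k) = w x k.
Proof.
rewrite eig_nsqe; have [lk|_] := eqVneq (l k) 0; last by rewrite mulr1.
by rewrite (eig_scale0 eT lk) ip0r csq0 mul0r.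
Qed.

Lemma nsq_expand n x :
  nsq x = \sum_(0 <= k < n) w x k + nsq (resid ip e n x).
Proof.
rewrite {1}(resid_split n x) nsqD.
rewrite (ipC ip) ip_resid_sum conjc0 /= mulr0 addr0.
rewrite -(big_mkord xpredT (fun k => ip x (e k) *: e k)) eig_nsq_sum.
by congr (_ + _); apply: eq_bigr => k _; rewrite w_nsqe.
Qed.

Lemma bessel n x : \sum_(0 <= k < n) w x k <= nsq x.
Proof. by rewrite (nsq_expand n x) lerDl nsq_ge0. Qed.

Lemma quad_expand n x :
  rip (T x) x = \sum_(0 <= k < n) l k * w x k
                + rip (T (resid ip e n x)) (resid ip e n x).
Proof.
have [h1 _ _ _ _] := eT.
set r := resid ip e n x; set s := \sum_(k < n) ip x (e k) *: e k.
have xE : x = s + r by exact: resid_split.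
have Ts : T s = \sum_(k < n) ((l k)%:C%C * ip x (e k)) *: e k.
  rewrite /s (lin_sum _ _ lT); apply: eq_bigr => k _.
  by rewrite (linZ _ _ lT) h1 scalerA mulrC.
have rTs : ip r (T s) = 0 by rewrite Ts ip_resid_sum.
rewrite {1 2}xE (linD _ _ lT) ipDl !(ipDr ip s r).
have -> : ip (T r) s = 0 by rewrite aT.
have -> : ip (T s) r = 0 by rewrite ipC rTs conjc0.
rewrite addr0 add0r raddfD /=; congr (_ + _).
have -> : ip (T s) s = ip (T s) x.
  by rewrite [in RHS]xE (ipDr ip s r) (ipC ip _ r) rTs conjc0 addr0.
rewrite Ts ip_suml raddf_sum big_mkord; apply: eq_bigr => k _.
rewrite ipZl (ipC ip (e k)) -mulrA csqE -rmorphM //=.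
Qed.

Lemma quad_resid n x :
  `|rip (T (resid ip e n x)) (resid ip e n x)| <= `|l n| * nsq x.
Proof.
set r := resid ip e n x; have [_ _ _ h4 _] := eT.
have rx : nsq r <= nsq x.
  rewrite (nsq_expand n x) lerDr; apply: sumr_ge0 => k _; exact: csq_ge0.
rewrite -(ler_pXn2r (n := 2)) ?nnegrE ?mulr_ge0 ?nsq_ge0 //.
rewrite real_normK ?num_real // exprMn real_normK ?num_real //.
apply: le_trans (CS_Re _ _ _) _.
have := h4 n r (ip_resid0 eT x (n := n)) => h.
apply: le_trans (ler_wpM2r (nsq_ge0 _ _) h) _.
rewrite -mulrA ler_wpM2l ?sqr_ge0 // -expr2.
by rewrite ler_pXn2r ?nnegrE ?nsq_ge0.
Qed.

(** The form at the residual is at most |l n| |x|^2. This gives convergence at every [x] although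
    the [e k] may miss the kernel of [T]. *)
Lemma quad_cvg x :
  \sum_(0 <= k < n) l k * w x k @[n --> \oo] --> rip (T x) x.
Proof.
have [_ _ _ _ h5] := eT.
have N1 : 0 < nsq x + 1 by rewrite ltr_wpDl // nsq_ge0.
apply/cvgrPdist_lt => d d0.
move/cvgrPdist_lt : h5 => /(_ (d / (nsq x + 1)) (divr_gt0 d0 N1)).
apply: filterS => n; rewrite sub0r normrN ltr_pdivlMr // => h.
rewrite {1}(quad_expand n x) addrC addKr.
apply: le_lt_trans (quad_resid _ _) _; apply: le_lt_trans h.
by rewrite ler_wpM2l // lerDl.
Qed.

Lemma quad_le n x : (forall k, 0 <= l k) ->
  \sum_(0 <= k < n) l k * w x k <= rip (T x) x.
Proof.
move=> l0.
rewrite -(cvg_lim (@Rhausdorff R) (@quad_cvg x)).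
apply: nondecreasing_cvgn_le; last by apply/cvg_ex; eexists; exact: quad_cvg.
apply/nondecreasing_seqP => k; rewrite big_nat_recr //= lerDl.
by rewrite mulr_ge0 // csq_ge0.
Qed.

Lemma eig_psd x : (forall k, 0 <= l k) -> 0 <= rip (T x) x.
Proof. by move=> l0; have := quad_le 0 x l0; rewrite big_geq. Qed.

Lemma psd_eig_ge0 : (forall x, 0 <= rip (T x) x) -> forall k, 0 <= l k.
Proof.
have [h1 _ _ _ _] := eT => pT k; have [->//|lk] := eqVneq (l k) 0.
have := pT (e k); rewrite h1 ipZl ip_nsq -rmorphM /= eig_nsqe lk mulr1 //.
Qed.

Lemma eigensystem_sqr : eigensystem ip (T \o T) e (fun i => l i ^+ 2).
Proof.
have [h1 h2 h3 h4 h5] := eT; split.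
- by move=> i; rewrite /= h1 (linZ _ _ lT) h1 scalerA -rmorphM -expr2.
- by move=> i j; rewrite h2 sqrf_eq0.
- by move=> i j ij; rewrite !normrX ler_pXn2r ?nnegrE // h3.
- move=> n x hx /=.
  have hTx i : (i < n)%N -> ip (T x) (e i) = 0.
    by move=> ni; rewrite aT h1 ipZr hx // mulr0.
  apply: le_trans (h4 _ _ hTx) _; rewrite [in leRHS]expr2 -mulrA.
  by rewrite ler_wpM2l ?sqr_ge0 // h4.
- have : (l n * l n) @[n --> \oo] --> (0 * 0 : R) by apply: cvgM.
  by rewrite mulr0; under eq_fun do rewrite -expr2.
Qed.

Lemma eigensystem_scale (c : R) : c != 0 ->
  eigensystem ip (fun x => c%:C%C *: T x) e (fun i => c * l i).
Proof.
have [h1 h2 h3 h4 h5] := eT; move=> c0; split.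
- by move=> i; rewrite h1 scalerA -rmorphM.
- by move=> i j; rewrite h2 mulf_eq0 (negPf c0).
- by move=> i j ij; rewrite !normrM ler_wpM2l // h3.
- move=> n x hx; rewrite nsqZ csq_real exprMn -[leRHS]mulrA.
  by rewrite ler_wpM2l ?sqr_ge0 // h4.
- have : (c * l n) @[n --> \oo] --> (c * 0 : R) by apply: cvgMr.
  by rewrite mulr0.
Qed.

(** The outer power cancels the root in [schatten_norm]; from here on singular values are replaced
    by eigenvalues. *)
Lemma schatten_eig q : 0 < q ->
  (schatten_norm ip q T `^ q = \sum_(0 <= i <oo) (`|l i| `^ q)%:E)%E.
Proof.
move=> q0; rewrite /schatten_norm -poweRrM mulVf ?gt_eqF //.
rewrite (singular_valuesE (eig_is_singular_values lT aT eT)).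
rewrite poweRe1 //; apply: nneseries_ge0 => n _ _.
by rewrite lee_fin powR_ge0.
Qed.

End Expansion.

(** * Construction of the absolute value of a compact self-adjoint operator *)

Section AbsoluteValue.
Context {R : realType} {H : completeNormedModType R[i]}.
Variable ip : {dot H for Num.conj}.
Hypothesis hip : norm_from_ip ip.
Variables (T : H -> H) (e : nat -> H) (l : nat -> R).
Hypothesis lT : linear T.
Hypothesis aT : is_adj ip T T.
Hypothesis eT : eigensystem ip T e l.

Local Notation nsq := (nsq ip).
Local Notation rip x y := (complex.Re (ip x y)).
Local Notation w x k := (csq (ip x (e k))).

(* The operator constructed is [|T|]; it is compact because
   [nsq (|T| x) <= nsq (T x)]. *)
Lemma eigensystem_abs : ucompact ip T -> exists S,
  [/\ linear S, ucompact ip S, is_adj ip S S & eigensystem ip S e (fun i => `|l i|)].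
Proof.
move=> cT; have [h1 h2 h3 h4 h5] := eT.
pose P n x := \sum_(0 <= k < n) (`|l k|%:C%C * ip x (e k)) *: e k.
have nsqP m n x : nsq (\sum_(m <= k < n) (`|l k|%:C%C * ip x (e k)) *: e k) =
    \sum_(m <= k < n) l k ^+ 2 * w x k.
  rewrite (eig_nsq_sum eT); apply: eq_bigr => k _.
  by rewrite csqM csq_real -mulrA (w_nsqe eT) real_normK // num_real.
have PT n x : nsq (P n x) <= nsq (T x).
  rewrite /P nsqP.
  have -> : nsq (T x) = rip ((T \o T) x) x by rewrite /= aT.
  have lTT : linear (T \o T) by move=> a u v; rewrite /= !lT.
  have aTT : is_adj ip (T \o T) (T \o T) := is_adj_comp aT aT.
  have sq0 k : 0 <= l k ^+ 2 by rewrite sqr_ge0.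
  exact: (quad_le lTT aTT (eigensystem_sqr lT aT eT)).
(* By Bessel, the block of [P] between m and n has squared norm at most (l m)^2 |x|^2. *)
have cauchyP x : cvg (P n x @[n --> \oo]).
  apply: (cauchy_nsq hip) => d d0.
  have N1 : 0 < nsq x + 1 by rewrite ltr_wpDl // nsq_ge0.
  have : (l n * l n) @[n --> \oo] --> (0 * 0 : R) by apply: cvgM.
  rewrite mulr0 => /cvgrPdist_lt /(_ _ (divr_gt0 d0 N1)) [N _ hN].
  exists [set n | (N <= n)%N]; first by exists N.
  have key m n : (N <= m)%N -> (m <= n)%N -> nsq (P n x - P m x) < d.
    move=> Nm mn; rewrite /P (big_cat_nat (n := m)) //= addrAC subrr add0r nsqP.
    have := hN m Nm; rewrite /= sub0r normrN -expr2 ger0_norm ?sqr_ge0 //.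
    rewrite ltr_pdivlMr // => h; apply: le_lt_trans h.
    apply: (@le_trans _ _ (l m ^+ 2 * nsq x)); last first.
      by rewrite ler_wpM2l ?sqr_ge0 // lerDl.
    apply: (@le_trans _ _ (\sum_(m <= k < n) l m ^+ 2 * w x k)).
      rewrite big_nat [leRHS]big_nat; apply: ler_sum => k /andP[mk _].
      rewrite ler_wpM2r ?csq_ge0 //.
      rewrite -[l k ^+ 2]real_normK ?num_real // -[l m ^+ 2]real_normK ?num_real //.
      by rewrite ler_pXn2r ?nnegrE // h3.
    rewrite -mulr_sumr ler_wpM2l ?sqr_ge0 //.
    apply: le_trans (bessel eT n x); rewrite [leRHS](big_cat_nat (n := m)) //=.
    by rewrite lerDr sumr_ge0 // => k _; exact: csq_ge0.
  move=> s t /= Ns Nt; have [st|ts] := leqP s t.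
    by rewrite nsqBC; exact: key.
  by apply: key => //; exact: ltnW.
have /choice[S PS] : forall x, exists y : H, P n x @[n --> \oo] --> y.
  by move=> x; have /cvg_ex := cauchyP x.
have Heq (f : nat -> H) (y z : H) : f n @[n --> \oo] --> y -> f n @[n --> \oo] --> z -> y = z.
  by move=> fy fz; exact: (cvg_unique (@norm_hausdorff _ H) fy fz).
have lS : linear S.
  move=> a u v; apply: Heq (PS _) _.
  have : (a *: P n u + P n v) @[n --> \oo] --> a *: S u + S v.
    by apply: cvgD => //; exact: cvgZr.
  under eq_fun do rewrite /P scaler_sumr -big_split /=.
  rewrite (_ : (fun n => _) = P^~ (a *: u + v)) //; apply/funext => n.
  apply: eq_bigr => k _; rewrite scalerA -scalerDl ipDl ipZl; congr (_ *: _).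
  by rewrite mulrDr mulrCA.
have aP n x y : ip (P n x) y = ip x (P n y).
  rewrite /P ip_suml ip_sumr; apply: eq_bigr => k _.
  rewrite ipZl ipZr (ipC ip (e k)) (_ : (_ * _)^*%C = `|l k|%:C%C * (ip y (e k))^*%C).
    by rewrite mulrAC.
  case: (ip y (e k)) => u v; apply/eqP; rewrite eq_complex /=.
  by apply/andP; split; apply/eqP; ring.
have aS : is_adj ip S S.
  apply: rip_is_adj => // x y.
  have h : rip (P n x) y @[n --> \oo] --> rip (S x) y by exact: cvg_rip.
  have k : rip (P n y) x @[n --> \oo] --> rip (S y) x by exact: cvg_rip.
  have ReC u v : rip u v = rip v u by rewrite ipC; case: (ip v u).
  rewrite [RHS]ReC; apply: (cvg_unique (@Rhausdorff R) h).
  rewrite (_ : (fun n => _) = (fun n => rip (P n y) x)) //.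
  by apply/funext => n; rewrite aP ReC.
have ST x : nsq (S x) <= nsq (T x).
  by apply: (nsq_lim_le hip _ (PS x)); apply: filterS filterT => n _ /=; exact: PT.
exists S; split => //.
  move=> U UU Ub; apply: (cauchy_nsq hip) => d d0.
  have [A UA hA] := cvg_cauchy_nsq hip _ d0 (cT U UU Ub).
  exists A => // s t As At; rewrite -(linB _ _ lS).
  by apply: le_lt_trans (ST _) _; rewrite (linB _ _ lT); exact: hA.
split.
- move=> i; apply: Heq (PS _) _; apply/(cvg_nsqP hip) => d d0.
  exists i.+1 => // n /= ni.
  have [li|li] := eqVneq (l i) 0.
    rewrite (eig_scale0 eT li) scaler0 subr0 /P big1 ?nsq0 // => k _.
    by rewrite ip0l mulr0 scale0r.
  rewrite /P (bigD1_seq i) ?iota_uniq ?mem_index_iota //= big1 ?addr0.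
    by rewrite h2 eqxx li mulr1 subrr nsq0.
  by move=> k ki; rewrite h2 eq_sym (negPf ki) mulr0 scale0r.
- by move=> i j; rewrite h2 normr_eq0.
- by move=> i j ij; rewrite !normr_id h3.
- move=> n x hx; rewrite real_normK ?num_real //.
  exact: le_trans (ST _) (h4 _ _ hx).
- by rewrite -(normr0 R); exact: cvg_norm.
Qed.

End AbsoluteValue.

(** The tangent at 1 of the concave power, read off Young's inequality with exponents 1/s and 1/(1 -
    s). It serves as Jensen's inequality for weights of sum at most 1. *)
Lemma powR_tangent (R : realType) (s x : R) : 0 < s < 1 -> 0 <= x ->
  x `^ s <= (1 - s) + s * x.
Proof.
move=> /andP[s0 s1] x0; have s1' : 0 < 1 - s by rewrite subr_gt0.
have := @conjugate_powR R (x `^ s) 1 s^-1 (1 - s)^-1.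
rewrite !invrK powR_ge0 ler01 !invr_gt0 s0 s1' => /(_ isT isT isT isT).
by rewrite addrC subrK -powRrM divff ?gt_eqF // powRr1 // powR1; lra.
Qed.

(** * Partial-sum versions of Rotfel'd's inequality and of trace monotonicity *)

Section Trace.
Context {R : realType} {H : completeNormedModType R[i]}.
Variable ip : {dot H for Num.conj}.
Hypothesis hip : norm_from_ip ip.
Implicit Types (x y z : H) (a b : R[i]) (e f : nat -> H) (l m : nat -> R).

Local Notation nsq := (nsq ip).
Local Notation rip x y := (complex.Re (ip x y)).

Definition psd (T : H -> H) :=
  [/\ linear T, is_adj ip T T & forall x, 0 <= rip (T x) x].

Lemma eig_ip_pos S f m j x : is_adj ip S S -> eigensystem ip S f m ->
  ip (S x) (f j) = (m j)%:C%C * ip x (f j).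
Proof. by move=> aS [h1 _ _ _ _]; rewrite aS h1 ipZr conjc_real. Qed.

Lemma quad_eig S f m j : eigensystem ip S f m ->
  rip (S (f j)) (f j) = m j.
Proof.
move=> eS; have [h1 _ _ _ _] := eS.
rewrite h1 ipZl ip_nsq -rmorphM /= (eig_nsqe eS).
by have [->|_] := eqVneq (m j) 0; rewrite ?mul0r // mulr1.
Qed.

(* This is [<Z^-1 f_j, f_j> <= 1 / m_j], the operator inequality [Z^-1 <= S^-1]
   tested on an eigenvector of [S]. *)
Lemma inverse_quad_le S Z e f l m j N : psd S -> psd Z ->
  (forall x, rip (S x) x <= rip (Z x) x) ->
  eigensystem ip Z e l -> eigensystem ip S f m ->
  m j * (\sum_(0 <= i < N) (l i)^-1 * csq (ip (f j) (e i))) <= 1.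
Proof.
move=> [lS aS pS] [lZ aZ pZ] SZ eZ eS.
set q := \sum_(_ <= _ < _) _.
have [h1 h2 _ _ _] := eZ.
have l0 := psd_eig_ge0 eZ pZ; have m0 := psd_eig_ge0 eS pS.
have q0 : 0 <= q.
  by apply: sumr_ge0 => i _; rewrite mulr_ge0 ?invr_ge0 ?csq_ge0.
(* [x] is a truncation of Z^-1 f_j, so <x, f_j> = <Z x, x> = q. Cauchy-Schwarz for [S] gives (m_j
   q)^2 <= <S x, x> m_j <= m_j q. *)
pose x := \sum_(0 <= i < N) ((l i)^-1%:C%C * ip (f j) (e i)) *: e i.
have xf : ip x (f j) = q%:C%C.
  rewrite /x ip_suml /q raddf_sum; apply: eq_bigr => i _.
  by rewrite ipZl (ipC ip (e i)) -mulrA csqE -rmorphM.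
have Zx : rip (Z x) x = q.
  rewrite {1}/x (lin_sum _ _ lZ) ip_suml raddf_sum /q.
  rewrite big_nat [RHS]big_nat; apply: eq_bigr => i /andP[_ iN].
  have [li|li] := eqVneq (l i) 0.
    by rewrite li invr0 !mul0r scale0r (lin0 lZ) ip0l.
  rewrite (linZ _ _ lZ) h1 !ipZl /x ip_sumr.
  rewrite (bigD1_seq i) ?iota_uniq ?mem_index_iota //= big1 ?addr0; last first.
    by move=> k ki; rewrite ipZr h2 eq_sym (negPf ki) mulr0.
  rewrite ipZr h2 eqxx li mulr1.
  rewrite /csq; case: (ip (f j) (e i)) => u v /=.
  by field.
have := psd_CS x (f j) lS aS pS.
rewrite (eig_ip_pos _ _ aS eS) xf -rmorphM csq_real (quad_eig _ eS) => h.
have {}h : (m j * q) ^+ 2 <= m j * q.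
  by rewrite -Zx [leRHS]mulrC Zx; apply: le_trans h _; rewrite ler_wpM2r // -Zx.
have mq := mulr_ge0 (m0 j) q0; rewrite leNgt; apply/negP => k.
by move: h; rewrite expr2 -[leRHS]mulr1 ler_pM2l ?leNgt ?k // (lt_trans ltr01).
Qed.

Variable r : R.
Hypothesis r01 : 0 < r < 1.

(** Divide by m_j^r and apply the tangent bound at m_j / l_i with weights |<f_j, e_i>|^2: their sum
    is at most 1 by Bessel and their mean of m_j / l_i at most 1 by [inverse_quad_le], so the total
    is at most r + (1 - r). *)
Lemma powR_inverse_quad_le S Z e f l m j N : psd S -> psd Z ->
  (forall x, rip (S x) x <= rip (Z x) x) ->
  eigensystem ip Z e l -> eigensystem ip S f m ->
  m j * (\sum_(0 <= i < N) l i `^ (r - 1) * csq (ip (f j) (e i))) <= m j `^ r.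
Proof.
move=> pS pZ SZ eZ eS.
have := inverse_quad_le j N pS pZ SZ eZ eS.
have l0 := psd_eig_ge0 eZ (let: And3 _ _ h := pZ in h).
have m0 := psd_eig_ge0 eS (let: And3 _ _ h := pS in h).
have [->|mj] := eqVneq (m j) 0; first by rewrite !mul0r powR_ge0.
have mj0 : 0 < m j by rewrite lt_def mj m0.
set q := \sum_(_ <= _ < _) _ => mq.
case/andP: r01 => r0 r1.
have s01 : 0 < 1 - r < 1 by rewrite subr_gt0 r1 /= ltrBlDr ltrDl.
have key : \sum_(0 <= i < N) (m j * (l i)^-1) `^ (1 - r) * csq (ip (f j) (e i)) <= 1.
  apply: (@le_trans _ _ (\sum_(0 <= i < N)
      (r * csq (ip (f j) (e i)) + (1 - r) * m j * ((l i)^-1 * csq (ip (f j) (e i)))))).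
    apply: ler_sum => i _.
    have -> : r * csq (ip (f j) (e i)) + (1 - r) * m j * ((l i)^-1 * csq (ip (f j) (e i)))
      = (1 - (1 - r) + (1 - r) * (m j * (l i)^-1)) * csq (ip (f j) (e i)) by ring.
    rewrite ler_wpM2r ?csq_ge0 // powR_tangent //.
    by rewrite mulr_ge0 ?invr_ge0.
  rewrite big_split /= -!mulr_sumr -/q.
  have := le_trans (bessel eZ N (f j)) (eig_nsqe_le eS j).
  by move: mq (ltW r0); move: (\sum_(0 <= i < N) csq _) => W mq r0' W1; nra.
have -> : m j * (\sum_(0 <= i < N) l i `^ (r - 1) * csq (ip (f j) (e i))) =
    m j `^ r * (\sum_(0 <= i < N) (m j * (l i)^-1) `^ (1 - r) * csq (ip (f j) (e i))).
  rewrite !mulr_sumr; apply: eq_bigr => i _; rewrite !mulrA; congr (_ * _).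
  rewrite powRM ?invr_ge0 // mulrA; have <- : m j = m j `^ r * m j `^ (1 - r).
    by rewrite -powRD ?mj ?implybT // addrC subrK powRr1.
  congr (_ * _).
  by rewrite -powR_inv1 // -powRrM mulN1r opprB.
by rewrite ler_piMr ?powR_ge0.
Qed.

Lemma weighted_trace_le S Z e f l m (B : R) N : psd S -> psd Z ->
  (forall x, rip (S x) x <= rip (Z x) x) ->
  eigensystem ip Z e l -> eigensystem ip S f m ->
  (forall n, \sum_(0 <= j < n) m j `^ r <= B) ->
  \sum_(0 <= i < N) l i `^ (r - 1) * rip (S (e i)) (e i) <= B.
Proof.
move=> pS pZ SZ eZ eS hB; have [lS aS _] := pS.
(* [N] stays fixed while the expansion of <S e_i, e_i> in the [f j] goes to the limit. *)
have h : (\sum_(0 <= i < N) l i `^ (r - 1) *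
    \sum_(0 <= j < n) m j * csq (ip (e i) (f j))) @[n --> \oo] -->
    \sum_(0 <= i < N) l i `^ (r - 1) * rip (S (e i)) (e i).
  apply: cvg_big => [|i _]; first exact: add_continuous.
  apply: cvgMr; exact: quad_cvg.
apply: (cvgr_to_le h); near=> n.
apply: le_trans (hB n).
under eq_bigr do rewrite mulr_sumr.
rewrite exchange_big /=; apply: ler_sum => j _.
have := powR_inverse_quad_le j N pS pZ SZ eZ eS.
rewrite mulr_sumr; apply: le_trans; rewrite le_eqVlt; apply/orP; left; apply/eqP.
by apply: eq_bigr => i _; rewrite csq_ipC mulrCA.
Unshelve. all: by end_near.
Qed.

Lemma trace_sum_le S T Z e f g l m m' (B B' : R) N : psd S -> psd T -> psd Z ->
  (forall x, rip (Z x) x = rip (S x) x + rip (T x) x) ->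
  eigensystem ip Z e l -> eigensystem ip S f m -> eigensystem ip T g m' ->
  (forall n, \sum_(0 <= j < n) m j `^ r <= B) ->
  (forall n, \sum_(0 <= j < n) m' j `^ r <= B') ->
  \sum_(0 <= i < N) l i `^ r <= B + B'.
Proof.
move=> pS pT pZ ZST eZ eS eT hB hB'.
have [_ _ pS0] := pS; have [_ _ pT0] := pT.
have SZ x : rip (S x) x <= rip (Z x) x by rewrite ZST lerDl.
have TZ x : rip (T x) x <= rip (Z x) x by rewrite ZST lerDr.
have := lerD (weighted_trace_le N pS pZ SZ eZ eS hB)
             (weighted_trace_le N pT pZ TZ eZ eT hB').
apply: le_trans; rewrite -big_split /=; apply: ler_sum => i _.
rewrite -mulrDr -ZST (quad_eig _ eZ).
have [->|li] := eqVneq (l i) 0.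
  by rewrite mulr0 powR0 // gt_eqF //; case/andP: r01.
have l0 : 0 <= l i by apply: (psd_eig_ge0 eZ); have [_ _] := pZ.
rewrite -[X in _ * X]powRr1 // -powRD ?subrK //.
by rewrite li implybT.
Qed.

(* Parseval's identity for [e i] in the system of [Z']: the kernel of [Z'] lies
   in that of [Z], hence is orthogonal to [e i]. *)
Lemma complete_of_le Z Z' e e' l l' i : psd Z -> psd Z' ->
  (forall x, rip (Z x) x <= rip (Z' x) x) ->
  eigensystem ip Z e l -> eigensystem ip Z' e' l' -> l i != 0 ->
  \sum_(0 <= j < n) csq (ip (e i) (e' j)) @[n --> \oo] --> (1 : R).
Proof.
move=> pZ pZ' ZZ' eZ eZ' li.
have [lZ aZ pZ0] := pZ; have [lZ' aZ' pZ'0] := pZ'.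
have [h1 _ _ _ _] := eZ.
have li0 : 0 < l i by rewrite lt_def li (psd_eig_ge0 eZ pZ0).
have [_ _ _ _ l'0] := eZ'.
have ne : nsq (e i) = 1 by rewrite (eig_nsqe eZ) li.
apply/cvgrPdist_lt => d d0.
(* With y the residual of e_i, Cauchy-Schwarz for [Z] gives (l_i |y|^2)^2 <= l_i <Z' y, y> <= l_i
   |l'_n|, so |y|^2 < d once |l'_n| < l_i d^2. *)
move/cvgrPdist_lt : l'0 => /(_ (l i * d ^+ 2)).
rewrite mulr_gt0 ?exprn_gt0 // => /(_ isT); apply: filterS => n.
rewrite sub0r normrN => hn.
have := nsq_expand eZ' n (e i); rewrite ne => ->.
rewrite addrC addKr ger0_norm ?nsq_ge0 //.
set y := resid ip e' n (e i).
rewrite -(ltr_pXn2r (n := 2)) ?nnegrE ?nsq_ge0 ?(ltW d0) //.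
rewrite -(ltr_pM2l li0); apply: le_lt_trans hn.
rewrite -(ler_pM2l li0).
have ye : rip y (e i) = nsq y.
  rewrite [in LHS](resid_split ip e' n (e i)) -/y ipDr.
  by rewrite (ip_resid_sum eZ') add0r.
have := psd_CS y (e i) lZ aZ pZ0.
rewrite (eig_ip_pos _ _ aZ eZ) (quad_eig _ eZ).
have -> : ip y (e i) = (nsq y)%:C%C.
  rewrite [in LHS](resid_split ip e' n (e i)) -/y ipDr.
  by rewrite (ip_resid_sum eZ') add0r ip_nsq.
rewrite -rmorphM csq_real => h.
rewrite mulrA -expr2 -exprMn; apply: le_trans h _.
rewrite mulrC ler_wpM2l ?(ltW li0) //.
apply: le_trans (ZZ' y) _; apply: le_trans (ler_norm _) _.
apply: le_trans (quad_resid eZ' n (e i)) _.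
by rewrite ne mulr1.
Qed.

(** Spread each l_i^r over the [e' j] by Parseval and sum over i first. For fixed j, the tangent of
    x^r at l'_j and the bound <Z e'_j, e'_j> <= l'_j leave at most l'_j^r. *)
Lemma trace_mono Z Z' e e' l l' (B : R) N : psd Z -> psd Z' ->
  (forall x, rip (Z x) x <= rip (Z' x) x) ->
  eigensystem ip Z e l -> eigensystem ip Z' e' l' ->
  (forall n, \sum_(0 <= j < n) l' j `^ r <= B) ->
  \sum_(0 <= i < N) l i `^ r <= B.
Proof.
move=> pZ pZ' ZZ' eZ eZ' hB; case/andP: (r01) => r0 r1.
have [lZ aZ pZ0] := pZ; have [lZ' aZ' pZ'0] := pZ'.
have l0 := psd_eig_ge0 eZ pZ0; have l'0 := psd_eig_ge0 eZ' pZ'0.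
have h : (\sum_(0 <= i < N) l i `^ r *
    \sum_(0 <= j < n) csq (ip (e i) (e' j))) @[n --> \oo] -->
    \sum_(0 <= i < N) l i `^ r * 1.
  apply: cvg_big => [|i _]; first exact: add_continuous.
  have [->|li] := eqVneq (l i) 0.
    rewrite powR0 ?gt_eqF // mul0r; under eq_fun do rewrite mul0r.
    exact: cvg_cst.
  by apply: cvgMr; apply: complete_of_le ZZ' eZ eZ' li.
under eq_bigr do rewrite -[_ `^ r]mulr1.
apply: (cvgr_to_le h); near=> n.
apply: le_trans (hB n).
under eq_bigr do rewrite mulr_sumr.
rewrite exchange_big /=; apply: ler_sum => j _.
have [l'j|l'j] := eqVneq (l' j) 0.
  rewrite l'j powR0 ?gt_eqF // big1 // => i _.
  by rewrite (eig_scale0 eZ' l'j) ip0r csq0 mulr0.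
have l'j0 : 0 < l' j by rewrite lt_def l'j l'0.
apply: (@le_trans _ _ (l' j `^ r * \sum_(0 <= i < N)
   ((1 - r) * csq (ip (e' j) (e i)) + r / l' j * (l i * csq (ip (e' j) (e i)))))).
  rewrite mulr_sumr; apply: ler_sum => i _.
  have -> : l i `^ r = l' j `^ r * (l i / l' j) `^ r.
    by rewrite -powRM ?divr_ge0 // mulrCA divff // mulr1.
  rewrite -mulrA ler_wpM2l ?powR_ge0 // csq_ipC.
  have -> : (1 - r) * csq (ip (e' j) (e i)) + r / l' j * (l i * csq (ip (e' j) (e i)))
    = (1 - r + r * (l i / l' j)) * csq (ip (e' j) (e i)) by ring.
  by rewrite ler_wpM2r ?csq_ge0 // powR_tangent // divr_ge0.
rewrite ler_piMr ?powR_ge0 // big_split /= -!mulr_sumr.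
have h1 := le_trans (bessel eZ N (e' j)) (eig_nsqe_le eZ' j).
have h2 : \sum_(0 <= i < N) l i * csq (ip (e' j) (e i)) <= l' j.
  apply: le_trans (quad_le lZ aZ eZ N (e' j) l0) _.
  by apply: le_trans (ZZ' _) _; rewrite (quad_eig _ eZ').
apply: (@le_trans _ _ ((1 - r) * 1 + r / l' j * l' j)).
  by apply: lerD; rewrite ler_wpM2l // ?subr_ge0 ?divr_ge0 ?(ltW r0) // ltW.
by rewrite divfK ?gt_eqF // mulr1 subrK.
Unshelve. all: by end_near.
Qed.

End Trace.

Lemma le_poweR (R : realType) (r : R) (x y : \bar R) : 0 <= r ->
  (0 <= x -> x <= y -> x `^ r <= y `^ r)%E.
Proof.
move=> r0 x0 xy; apply: gt0_ler_poweR => //; rewrite in_itv /= leey andbT //.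
exact: le_trans xy.
Qed.

(** * Scaling, squaring and Rotfel'd's inequality for Schatten quasi-norms *)

Section SchattenSums.
Context {R : realType} {H : completeNormedModType R[i]}.
Variable ip : {dot H for Num.conj}.
Hypothesis hip : norm_from_ip ip.
Implicit Types (x y z : H) (a b : R[i]) (S T Z : H -> H).

Local Notation nsq := (nsq ip).
Local Notation rip x y := (complex.Re (ip x y)).

Lemma schatten_norm_ge0 q T : (0 <= schatten_norm ip q T)%E.
Proof. exact: poweR_ge0. Qed.

Lemma compact_selfadjD S T : compact_selfadj ip S -> compact_selfadj ip T -> compact_selfadj ip (fun x => S x + T x).
Proof.
move=> [lS cS aS] [lT cT aT]; split; last exact: is_adjD.
  by move=> a u v; rewrite lS lT scalerDr addrACA.
exact: ucompactD.
Qed.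

Lemma compact_selfadjZ (c : R) T : compact_selfadj ip T -> compact_selfadj ip (fun x => c%:C%C *: T x).
Proof.
move=> [lT cT aT]; split.
- by move=> a u v; rewrite lT scalerDr !scalerA mulrC.
- exact: ucompactZ.
- by have := is_adjZ c%:C%C aT; rewrite conjc_real.
Qed.

Lemma compact_selfadj_sqr T : compact_selfadj ip T -> compact_selfadj ip (op_sqr T).
Proof.
move=> [lT cT aT]; split; last exact: is_adj_comp.
  by move=> a u v; rewrite /op_sqr /= !lT.
by apply: ucompact_comp => //; exact: ucompact_bdd.
Qed.

Lemma psd_sqr T : compact_selfadj ip T -> psd ip (op_sqr T).
Proof.
move=> sT; have [lTT _ aTT] := compact_selfadj_sqr sT; have [_ _ aT] := sT.
by split => // x; rewrite /op_sqr /= aT; exact: nsq_ge0.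
Qed.

Lemma psdZ (c : R) T : 0 <= c -> psd ip T -> psd ip (fun x => c%:C%C *: T x).
Proof.
move=> c0 [lT aT pT]; split.
- by move=> a u v; rewrite lT scalerDr !scalerA mulrC.
- by have := is_adjZ c%:C%C aT; rewrite conjc_real.
- move=> x; rewrite ipZl; have := pT x; case: (ip (T x) x) => u v /= u0.
  by rewrite mul0r subr0 mulr_ge0.
Qed.

Lemma schatten_sqr q T : 0 < q -> compact_selfadj ip T ->
  (schatten_norm ip (q / 2) (op_sqr T) `^ (q / 2) = schatten_norm ip q T `^ q)%E.
Proof.
move=> q0 sT; have [e [l eT]] := spectral hip sT.
have [lT cT aT] := sT; have [lTT cTT aTT] := compact_selfadj_sqr sT.
rewrite (schatten_eig lTT aTT (eigensystem_sqr lT aT eT)) ?divr_gt0 //.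
rewrite (schatten_eig lT aT eT) //; apply: eq_eseriesr => i _; congr (_%:E).
by rewrite normrX -powR_mulrn // -powRrM mulrC divfK.
Qed.

Lemma schatten_scale q (c : R) T : 0 < q -> 0 < c -> compact_selfadj ip T ->
  (schatten_norm ip q (fun x => c%:C%C *: T x)%R `^ q
   = (c `^ q)%:E * schatten_norm ip q T `^ q)%E.
Proof.
move=> q0 c0 sT; have [e [l eT]] := spectral hip sT.
have [lT cT aT] := sT; have [lcT ccT acT] := compact_selfadjZ c sT.
have cn0 : c != 0 by rewrite gt_eqF.
rewrite [LHS](schatten_eig lcT acT (eigensystem_scale eT cn0) q0).
rewrite (schatten_eig lT aT eT q0) -nneseriesZl; last first.
  by move=> i _; rewrite lee_fin powR_ge0.
apply: eq_eseriesr => i _.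
by rewrite -EFinM normrM (gtr0_norm c0) powRM // ltW.
Qed.

Lemma schatten_subadd r S T Z : 0 < r < 1 ->
  compact_selfadj ip S -> compact_selfadj ip T -> compact_selfadj ip Z -> psd ip S -> psd ip Z ->
  (forall x, Z x = S x + T x) ->
  (schatten_norm ip r Z `^ r
   <= schatten_norm ip r S `^ r + schatten_norm ip r T `^ r)%E.
Proof.
move=> r01 sS sT sZ pS pZ ZST; case/andP: (r01) => r0 _.
have [e [l eZ]] := spectral hip sZ.
have [f [m eS]] := spectral hip sS.
have [g [k eT]] := spectral hip sT.
have [lS cS aS] := sS; have [lT cT aT] := sT; have [lZ cZ aZ] := sZ.
have [T' [lT' cT' aT' eT']] := eigensystem_abs hip lT aT eT cT.
have pT' : psd ip T'.
  by split=> // x; apply: (eig_psd lT' aT' eT') => i; exact: normr_ge0.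
have sZ' : compact_selfadj ip (fun x => S x + T' x) by apply: compact_selfadjD.
have [e' [l' eZ']] := spectral hip sZ'.
have ripD x : rip (S x + T' x) x = rip (S x) x + rip (T' x) x.
  by rewrite ipDl raddfD.
have pZ' : psd ip (fun x => S x + T' x).
  case: sZ' => lZ' _ aZ'; split => // x.
  by have [_ _ p1] := pS; have [_ _ p2] := pT'; rewrite ripD addr_ge0.
have ZZ' x : rip (Z x) x <= rip (S x + T' x) x.
  rewrite ripD ZST ipDl raddfD lerD2l.
  (* <T x, x> <= <|T| x, x> is compared term by term: both forms are diagonal in [g], with entries
     k_i and |k_i|. *)
  have h : \sum_(0 <= i < n) k i * csq (ip x (g i)) @[n --> \oo] --> rip (T x) x.
    exact: quad_cvg.
  apply: (cvgr_to_le h); near=> n.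
  apply: le_trans (quad_le lT' aT' eT' n x _); last by move=> ?; exact: normr_ge0.
  by apply: ler_sum => i _; rewrite ler_wpM2r ?csq_ge0 // ler_norm.
rewrite [leLHS](schatten_eig lZ aZ eZ r0) [X in (_ <= X + _)%E](schatten_eig lS aS eS r0).
rewrite [X in (_ <= _ + X)%E](schatten_eig lT aT eT r0).
set BS := (\sum_(_ <= _ <oo) (`|m _| `^ r)%:E)%E.
set BT := (\sum_(_ <= _ <oo) (`|k _| `^ r)%:E)%E.
have BS0 : (0 <= BS)%E by apply: nneseries_ge0 => i _ _; rewrite lee_fin powR_ge0.
have BT0 : (0 <= BT)%E by apply: nneseries_ge0 => i _ _; rewrite lee_fin powR_ge0.
(* A divergent right-hand side is trivial; otherwise [fine] supplies the real bounds on partial sums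
   that the trace lemmas take. *)
have [->|BSoo] := eqVneq BS +oo%E; first by rewrite addye ?leey // -ltNye (lt_le_trans ltNy0).
have [->|BToo] := eqVneq BT +oo%E; first by rewrite addey ?leey // -ltNye (lt_le_trans ltNy0).
have BSf : BS \is a fin_num by rewrite ge0_fin_numE // ltey.
have BTf : BT \is a fin_num by rewrite ge0_fin_numE // ltey.
have part (u : nat -> R) (B : \bar R) : B \is a fin_num ->
    B = (\sum_(0 <= i <oo) (`|u i| `^ r)%:E)%E ->
    forall n, \sum_(0 <= i < n) `|u i| `^ r <= fine B.
  move=> Bf BE n; rewrite -lee_fin fineK // BE -sumEFin.
  by apply: nneseries_lim_ge => i _ _; rewrite lee_fin powR_ge0.
have hS n : \sum_(0 <= i < n) m i `^ r <= fine BS.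
  apply: le_trans (part m BS BSf erefl n); apply: ler_sum => i _.
  by rewrite ger0_norm // (psd_eig_ge0 eS) //; have [] := pS.
have hT := part k BT BTf erefl.
apply: lime_le; first by apply: is_cvg_nneseries => i _ _; rewrite lee_fin powR_ge0.
near=> n; rewrite sumEFin -(fineK BSf) -(fineK BTf) -EFinD lee_fin.
apply: (@le_trans _ _ (\sum_(0 <= i < n) l i `^ r)).
  apply: ler_sum => i _.
  by rewrite ger0_norm // (psd_eig_ge0 eZ) //; have [] := pZ.
apply: (trace_mono r01 n pZ pZ' ZZ' eZ eZ') => N.
exact: (trace_sum_le r01 N pS pT' pZ' ripD eZ' eS eT' hS hT).
Unshelve. all: by end_near.
Qed.

End SchattenSums.

(** * Algebra of the real and imaginary parts of rotated operators *)

Section CartesianParts.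
Context {R : realType} {H : completeNormedModType R[i]}.
Variable ip : {dot H for Num.conj}.
Hypothesis hip : norm_from_ip ip.
Implicit Types (x y z : H) (a b : R[i]) (A B S T : H -> H).

Lemma adjointP T : linear T -> ucompact ip T -> is_adj ip T (adjoint ip T).
Proof.
move=> lT cT; have [S hS] := adj_exists hip lT (ucompact_bdd hip lT cT).
by rewrite (adjointE hS).
Qed.

Lemma re_op_compact_selfadj T : linear T -> ucompact ip T -> compact_selfadj ip (re_op ip T).
Proof.
move=> lT cT; have aT := adjointP lT cT; have lT' := is_adj_lin aT.
have -> : re_op ip T = (fun x => (2^-1 : R)%:C%C *: (T x + adjoint ip T x)).
  by apply/funext => x; rewrite /re_op fmorphV rmorph_nat.
apply: compact_selfadjZ; split.
- by move=> a u v; rewrite lT lT' scalerDr addrACA.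
- by apply: ucompactD => //; exact: ucompact_adj aT.
- have -> : is_adj ip (fun x => T x + adjoint ip T x) = is_adj ip (fun x => adjoint ip T x + T x).
    by congr is_adj; apply/funext => x; rewrite addrC.
  exact: is_adjD (is_adj_sym aT) aT.
Qed.

Lemma linear_rotate t T : linear T -> linear (rotate t T).
Proof. by move=> lT a u v; rewrite /rotate lT scalerDr !scalerA mulrC. Qed.

Lemma re_rotate_compact_selfadj t T : linear T -> ucompact ip T ->
  compact_selfadj ip (re_op ip (rotate t T)).
Proof.
move=> lT cT; apply: re_op_compact_selfadj; first exact: linear_rotate.
exact: ucompactZ.
Qed.

Lemma adjoint_rotate t T : linear T -> ucompact ip T ->
  adjoint ip (rotate t T) = (fun x => (expi t)^*%C *: adjoint ip T x).
Proof.
by move=> lT cT; apply: adjointE; apply: is_adjZ; exact: adjointP.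
Qed.

Lemma expiJ t : (expi t)^*%C * expi t = 1 :> R[i].
Proof.
rewrite mulrC csqE /csq /expi /= cos2Dsin2 //.
Qed.

Lemma expi_sqr (t : R) : expi t * expi t = expi (t + t).
Proof.
rewrite /expi sinD cosD; apply/eqP; rewrite eq_complex /=.
by apply/andP; split; apply/eqP; ring.
Qed.

(** Im(S) = Re(-iS) and -i = e^{-i pi/2}. Thus imaginary parts also occur in the supremum defining
    [schatten_numradius]. *)
Lemma im_op_rotate t T : linear T -> ucompact ip T ->
  im_op ip (rotate t T) = re_op ip (rotate (t - pi / 2) T).
Proof.
move=> lT cT; apply/funext => x; rewrite /im_op /re_op !adjoint_rotate // /rotate.
have -> : expi (t - pi / 2) = - 'i%C * expi t :> R[i].
  rewrite /expi sinB cosB sin_pihalf cos_pihalf.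
  apply/eqP; rewrite eq_complex /=.
  by apply/andP; split; apply/eqP; ring.
have i2 : ('i%C : R[i]) * 'i%C = -1 by rewrite -expr2 sqr_i.
have iV : ('i%C : R[i])^-1 = - 'i%C.
  apply: (mulfI (x := 'i%C)); first by rewrite eq_complex /= oner_eq0 andbF.
  rewrite divff ?mulrN ?i2 ?opprK //.
  by rewrite eq_complex /= oner_eq0 andbF.
rewrite invfM iV scalerBr scalerDr !scalerA -scaleNr.
congr (_ *: _ + _ *: _); first by ring.
rewrite conjcM (_ : (- 'i%C)^*%C = 'i%C :> R[i]); first by ring.
by apply/eqP; rewrite eq_complex /= opprK oppr0 !eqxx.
Qed.

Lemma re_sqr t T x : linear T -> ucompact ip T ->
  op_sqr (re_op ip (rotate t T)) x
  = (4^-1 : R)%:C%C *: abs_sum ip T x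
    + (2^-1 : R)%:C%C *: re_op ip (rotate (t + t) (op_sqr T)) x.
Proof.
move=> lT cT; have aT := adjointP lT cT; have lT' := is_adj_lin aT.
have lTT : linear (op_sqr T) by move=> a u v; rewrite /op_sqr /= !lT.
have -> : re_op ip (rotate (t + t) (op_sqr T)) x = 2^-1 *:
    (expi (t + t) *: T (T x)
     + (expi (t + t))^*%C *: adjoint ip T (adjoint ip T x)).
  rewrite /re_op (adjointE (S := fun y => (expi (t + t))^*%C *:
    adjoint ip T (adjoint ip T y))) //.
  by apply: is_adjZ; exact: is_adj_comp.
rewrite -expi_sqr conjcM /op_sqr /abs_sum /re_op /comp !adjoint_rotate // /rotate.
rewrite !((linZ _ _ lT), (linZ _ _ lT'), (linD _ _ lT), (linD _ _ lT')).
rewrite !(scalerDr, scalerA).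
(* The mixed products come first: their phases cancel and they form [abs_sum]. The two pure squares
   carry e^{2it} and its conjugate. *)
rewrite [LHS](AC (2 * 2) ((3 * 2) * (1 * 4))).
have h4 : (4^-1 : R)%:C%C = 2^-1 * 2^-1 :> R[i].
  by rewrite -invfM -natrM fmorphV rmorph_nat.
have h2 : (2^-1 : R)%:C%C = 2^-1 :> R[i] by rewrite fmorphV rmorph_nat.
have EJ := expiJ t.
rewrite h4 h2; congr (_ *: _ + _ *: _ + (_ *: _ + _ *: _)).
- by rewrite -[RHS]mulr1 -EJ; ring.
- by rewrite -[RHS]mulr1 -EJ; ring.
- by ring.
- by ring.
Qed.

(** Use [re_sqr] at t and t - pi/2: the doubled angles differ by pi, so the terms in [op_sqr T]
    cancel and 1/4 + 1/4 = 1/2 remains. *)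
Lemma re_sqrD_im_sqr t T x : linear T -> ucompact ip T ->
  (2^-1 : R)%:C%C *: abs_sum ip T x
  = op_sqr (re_op ip (rotate t T)) x + op_sqr (im_op ip (rotate t T)) x.
Proof.
move=> lT cT; rewrite im_op_rotate // !re_sqr //.
set s := t - pi / 2.
have aT := adjointP lT cT.
have EN : expi (s + s) = - expi (t + t) :> R[i].
  have -> : s + s = t + t - pi by rewrite /s; field.
  rewrite /expi sinB cosB cospi sinpi.
  by apply/eqP; rewrite eq_complex /=; apply/andP; split; apply/eqP; ring.
have reE u : re_op ip (rotate u (op_sqr T)) x = 2^-1 *:
    (expi u *: T (T x) + (expi u)^*%C *: adjoint ip T (adjoint ip T x)).
  rewrite /re_op (adjointE (S := fun y => (expi u)^*%C *:
    adjoint ip T (adjoint ip T y))) //.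
  by apply: is_adjZ; exact: is_adj_comp.
rewrite !reE EN rmorphN !scaleNr -opprD !scalerN addrACA subrr addr0 -scalerDl.
by rewrite -rmorphD; congr (_%:C%C *: _); field.
Qed.

End CartesianParts.

Lemma powR_invl (R : realType) (x y : R) : 0 <= x -> x^-1 `^ y = (x `^ y)^-1.
Proof. by move=> x0; rewrite -powR_inv1 // -powRrM mulN1r powRN. Qed.

(** (u + v)/2 + |u - v|/2 = max(u, v) at each index. A finite [W] makes all [a i] and [b i] finite,
    and [C] too through [i0], which justifies the subtraction in [\bar R]. *)
Lemma half_sum_sup_le (R : realType) (I : Type) (i0 : I) (a b : I -> \bar R)
    (C W : \bar R) (k : R) : 0 < k ->
  (0 <= C)%E -> (forall i, 0 <= a i)%E -> (forall i, 0 <= b i)%E ->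
  (forall i, k%:E * C <= a i + b i)%E ->
  (forall i, a i <= W)%E -> (forall i, b i <= W)%E ->
  ((k / 2)%:E * C
   + ereal_sup [set `|a i - b i| * (1 / 2)%:E | i in [set: I]] <= W)%E.
Proof.
move=> k0 C0 a0 b0 Cab aW bW.
have [->|Woo] := eqVneq W +oo%E; first by rewrite leey.
have fin (x : \bar R) : (0 <= x -> x <= W -> x \is a fin_num)%E.
  by move=> x0 xW; rewrite ge0_fin_numE // (le_lt_trans xW) // ltey.
have Wf : W \is a fin_num by apply: fin => //; exact: le_trans (a0 i0) (aW i0).
have Cf : C \is a fin_num.
  rewrite ge0_fin_numE // ltey; apply/eqP => Coo.
  have := Cab i0; rewrite Coo gt0_muley ?lte_fin // leye_eq => /eqP h.
  have : (a i0 + b i0)%E \is a fin_num by rewrite fin_numD !fin.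
  by rewrite h.
rewrite addeC -leeBrDr ?fin_numM //.
apply: ge_ereal_sup => _ [i _ <-].
move: (Cab i) (aW i) (bW i).
rewrite -(fineK (fin _ (a0 i) (aW i))) -(fineK (fin _ (b0 i) (bW i))).
rewrite -(fineK Cf) -(fineK Wf).
move: (fine (a i)) (fine (b i)) (fine C) (fine W) => u v c w.
rewrite !lee_fin.
by have [uv|uv] := ler0P (u - v); lra.
Qed.

(** * The two bounds at a fixed angle, and the passage to the supremum *)

Section Radius.
Context {R : realType} {H : completeNormedModType R[i]}.
Variable ip : {dot H for Num.conj}.
Hypothesis hip : norm_from_ip ip.
Implicit Types (A : H -> H).

Lemma schatten_numradius_ge q A t : 0 <= q ->
  (schatten_norm ip q (re_op ip (rotate t A)) `^ q
   <= schatten_numradius ip q A `^ q)%E.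
Proof.
move=> q0; apply: le_poweR => //; first exact: schatten_norm_ge0.
by apply: ereal_sup_ubound; exists t.
Qed.

Lemma schatten_numradius_le q A (K : \bar R) : 0 < q ->
  (forall t, (schatten_norm ip q (re_op ip (rotate t A)) `^ q <= K)%E) ->
  (schatten_numradius ip q A `^ q <= K)%E.
Proof.
move=> q0 hK.
have K0 : (0 <= K)%E by apply: le_trans (hK 0); exact: poweR_ge0.
have KE : K = ((K `^ q^-1) `^ q)%E by rewrite -poweRrM mulVf ?gt_eqF // poweRe1.
rewrite [leRHS]KE; apply: le_poweR; first exact: ltW.
  apply: le_trans (schatten_norm_ge0 ip q (re_op ip (rotate 0 A))) _.
  by apply: ereal_sup_ubound; exists 0.
apply: ge_ereal_sup => _ [t _ <-].
have -> : schatten_norm ip q (re_op ip (rotate t A)) =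
    ((schatten_norm ip q (re_op ip (rotate t A)) `^ q) `^ q^-1)%E.
  by rewrite -poweRrM divff ?gt_eqF // poweRe1 // schatten_norm_ge0.
by apply: le_poweR (hK t); rewrite ?invr_ge0 ?poweR_ge0 // ltW.
Qed.

Variables (p : R) (A : H -> H).
Hypothesis hp : 0 < p < 2.
Hypothesis lA : linear A.
Hypothesis cA : ucompact ip A.

Let p0 : 0 < p. Proof. by case/andP: hp. Qed.
Let r01 : 0 < p / 2 < 1.
Proof. by case/andP: hp => ? ?; rewrite divr_gt0 //= ltr_pdivrMr // mul1r. Qed.
Let r0 : 0 < p / 2. Proof. by case/andP: r01. Qed.

Lemma compact_selfadj_abs_sum : compact_selfadj ip (abs_sum ip A).
Proof.
have h := re_sqrD_im_sqr hip 0 _ lA cA.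
have -> : abs_sum ip A = (fun x => 2%:C%C *:
    (op_sqr (re_op ip (rotate 0 A)) x + op_sqr (im_op ip (rotate 0 A)) x)).
  apply/funext => x; rewrite -h scalerA -rmorphM divff // rmorph1 scale1r //.
apply: compact_selfadjZ; apply: compact_selfadjD; apply: (compact_selfadj_sqr hip).
  exact: re_rotate_compact_selfadj.
by rewrite im_op_rotate //; exact: re_rotate_compact_selfadj.
Qed.

Lemma psd_abs_sum : psd ip (abs_sum ip A).
Proof.
have [lS _ aS] := compact_selfadj_abs_sum; split => // x.
have aA := adjointP hip lA cA.
rewrite /abs_sum ipDl raddfD; apply: addr_ge0.
  by rewrite (is_adj_sym aA); exact: nsq_ge0.
by rewrite aA; exact: nsq_ge0.
Qed.

(** Rotfel'd's inequality for X^2 + Y^2 = [abs_sum]/2; the factor is (1/2)^(p/2). *)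
Lemma abs_sum_le t :
  ((1 / 2 `^ (p / 2))%:E * schatten_norm ip (p / 2) (abs_sum ip A) `^ (p / 2)
   <= schatten_norm ip p (re_op ip (rotate t A)) `^ p
      + schatten_norm ip p (im_op ip (rotate t A)) `^ p)%E.
Proof.
have sX := re_rotate_compact_selfadj hip t lA cA.
have sY : compact_selfadj ip (im_op ip (rotate t A)).
  by rewrite im_op_rotate //; exact: re_rotate_compact_selfadj.
have -> : 1 / 2 `^ (p / 2) = (2^-1 : R) `^ (p / 2).
  by rewrite powR_invl // div1r.
rewrite -(schatten_scale hip r0 _ compact_selfadj_abs_sum) ?invr_gt0 //.
rewrite -[X in (_ <= X + _)%E](schatten_sqr hip p0 sX).
rewrite -[X in (_ <= _ + X)%E](schatten_sqr hip p0 sY).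
apply: (schatten_subadd hip r01).
- exact: compact_selfadj_sqr.
- exact: compact_selfadj_sqr.
- by apply: compact_selfadjZ; exact: compact_selfadj_abs_sum.
- exact: psd_sqr.
- by apply: psdZ; [rewrite invr_ge0 | exact: psd_abs_sum].
- by move=> x; rewrite (re_sqrD_im_sqr hip t x lA cA).
Qed.

(** Rotfel'd's inequality for [re_sqr], with [S] equal to [abs_sum]/4; the factors are (1/4)^(p/2) =
    2^-p and (1/2)^(p/2). *)
Lemma re_rotate_le t :
  (schatten_norm ip p (re_op ip (rotate t A)) `^ p
   <= (1 / 2 `^ p)%:E * schatten_norm ip (p / 2) (abs_sum ip A) `^ (p / 2)
      + (1 / 2 `^ (p / 2))%:E
        * schatten_norm ip (p / 2) (re_op ip (rotate (t + t) (op_sqr A))) `^ (p / 2))%E.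
Proof.
have sX := re_rotate_compact_selfadj hip t lA cA.
have lAA : linear (op_sqr A) by move=> a u v; rewrite /op_sqr /= !lA.
have cAA : ucompact ip (op_sqr A).
  exact: ucompact_comp lA cA (ucompact_bdd hip lA cA).
have sB := re_rotate_compact_selfadj hip (t + t) lAA cAA.
have -> : 1 / 2 `^ (p / 2) = (2^-1 : R) `^ (p / 2).
  by rewrite powR_invl // div1r.
have -> : 1 / 2 `^ p = (4^-1 : R) `^ (p / 2).
  have -> : (4 : R) = 2 `^ 2 by rewrite powR_mulrn // -natrX.
  by rewrite powR_invl ?powR_ge0 // -powRrM [2 * _]mulrC divfK // div1r.
rewrite -[X in (_ <= X + _)%E](schatten_scale hip r0 _ compact_selfadj_abs_sum) ?invr_gt0 //.
rewrite -[X in (_ <= _ + X)%E](schatten_scale hip r0 _ sB) ?invr_gt0 //.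
rewrite -[leLHS](schatten_sqr hip p0 sX).
apply: (schatten_subadd hip r01).
- by apply: compact_selfadjZ; exact: compact_selfadj_abs_sum.
- exact: compact_selfadjZ.
- exact: compact_selfadj_sqr.
- by apply: psdZ; [rewrite invr_ge0 | exact: psd_abs_sum].
- exact: psd_sqr.
- by move=> x; rewrite (re_sqr hip t x lA cA).
Qed.

End Radius.

Theorem proposition5p9 (R : realType) (H : completeNormedModType R[i])
    (ip : {dot H for Num.conj})
    (hip : norm_from_ip ip) (hsep : separable_space H)
    (p : R) (hp1 : 1 <= p) (hp2 : p < 2)
    (A : H -> H) (hA : schatten_class ip p A) :
  ((1 / 2 `^ (p / 2 + 1))%:E * schatten_norm ip (p / 2) (abs_sum ip A) `^ (p / 2)
     + ereal_sup
         [set `| schatten_norm ip (p / 2)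
                   (op_sqr (re_op ip (rotate t A))) `^ (p / 2)
                 - schatten_norm ip (p / 2)
                   (op_sqr (im_op ip (rotate t A))) `^ (p / 2) |
              * (1 / 2)%:E | t in [set: R]]
   <= schatten_numradius ip p A `^ p)%E
  /\
  (schatten_numradius ip p A `^ p
   <= (1 / 2 `^ p)%:E * schatten_norm ip (p / 2) (abs_sum ip A) `^ (p / 2)
      + (1 / 2 `^ (p / 2))%:E
        * schatten_numradius ip (p / 2) (op_sqr A) `^ (p / 2))%E.
Proof.
have [[lA pA] _] := hA; have cA := compact_operator_ucompact hip (conj lA pA).
have p0 : 0 < p by exact: lt_le_trans hp1.
have hp : 0 < p < 2 by rewrite p0 hp2.
split; last first.
  apply: schatten_numradius_le => // t.
  apply: le_trans (re_rotate_le hip hp lA cA t) _.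
  apply: leeD2l; apply: lee_wpmul2l; first by rewrite lee_fin divr_ge0 ?powR_ge0.
  (* The doubled angle t + t is one of the angles in the supremum for [op_sqr A]. *)
  by apply: schatten_numradius_ge; rewrite divr_ge0 // ltW.
have k0 : 0 < 1 / 2 `^ (p / 2) :> R by rewrite divr_gt0 // powR_gt0.
have -> : 1 / 2 `^ (p / 2 + 1) = 1 / 2 `^ (p / 2) / 2 :> R.
  by rewrite powRD ?pnatr_eq0 ?implybT // powRr1 // invfM mulrA.
have sX t := re_rotate_compact_selfadj hip t lA cA.
have sY t : compact_selfadj ip (im_op ip (rotate t A)).
  by rewrite im_op_rotate //; exact: re_rotate_compact_selfadj.
apply: (half_sum_sup_le 0 k0).
- exact: poweR_ge0.
- by move=> t; exact: poweR_ge0.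
- by move=> t; exact: poweR_ge0.
- move=> t; rewrite [X in (_ <= X + _)%E](schatten_sqr hip p0 (sX t)).
  rewrite [X in (_ <= _ + X)%E](schatten_sqr hip p0 (sY t)).
  exact: abs_sum_le.
- move=> t; rewrite [leLHS](schatten_sqr hip p0 (sX t)).
  by apply: schatten_numradius_ge; exact: ltW.
- move=> t; rewrite [leLHS](schatten_sqr hip p0 (sY t)) im_op_rotate //.
  by apply: schatten_numradius_ge; exact: ltW.
Qed.
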